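(* Let $\sigma$ be a triangulation of a polygon $P$ with $n\ge3$ vertices and $\Gamma_\sigma$ its frozen Jacobian algebra. Let $T_\sigma:=e_F\Gamma_\sigma$, regarded as a left module over $\Lambda\cong e_F\Gamma_\sigma e_F$; then $T_\sigma\cong\bigoplus_{(P_s,P_t)\in\sigma,\ s<t}(s,t)$, the sum running over all sides and diagonals of $\sigma$. Moreover, right multiplication induces an isomorphism of algebras $\operatorname{End}_\Lambda(T_\sigma)\cong\Gamma_\sigma^{\mathrm{op}}$.
   Context: Let $K$ be a field, $R=K[x]$. $P$ is a regular polygon with vertices $P_1,\dots,P_n$ counterclockwise, $\sigma$ a triangulation (maximal set of non-crossing diagonals), with edges the sides of $P$ and the diagonals of $\sigma$. $Q_\sigma$ has vertices the edges of $\sigma$; internal arrows $a\to b$ when $a,b$ are sides of a common triangle and $a$ precedes $b$ anticlockwise around their common vertex; external arrows $a\to b$ between the two sides of $P$ at each polygon vertex incident to a diagonal, $a$ preceding $b$ anticlockwise. $W_\sigma=\sum$(cyclic triangles: three internal arrows in a triangle) $-\sum$(big cycles: internal arrows plus one external arrow around a vertex of $P$); $F$ = vertices corresponding to sides; $\Gamma_\sigma=KQ_\sigma/J$ where $J$ is generated by cyclic derivatives $\partial_aW_\sigma$ ($\partial_a(a_1\cdots a_d)=\sum_{a_i=a}a_{i+1}\cdots a_da_1\cdots a_{i-1}$) for arrows with source or target not in $F$. $e_F=\sum_{i\in F}e_i$. $R$ acts on $\Gamma_\sigma$ via $x\mapsto C=\sum_iC_i$, $C_i$ the common class in $\Gamma_\sigma$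 of the minimal cycles through $i$. $\Lambda$ is the tiled $R$-order in $M_n(K(x))$ with $(i,j)$ entry $x^{c_{ij}}R$, $c_{ij}=0$ if $i\le j$ except $c_{1n}=-1$, $c_{ij}=1$ if $i=j+1$, $c_{ij}=2$ if $i\ge j+2$; it is isomorphic as $R$-order to $e_F\Gamma_\sigma e_F$, and $e_F\Gamma_\sigma$ is a $\Lambda$-module through a suitable such isomorphism. $(s,t)$ ($1\le s<t\le n$) is the $\Lambda$-module $[R^{s}\,(x)^{t-s}\,(x^2)^{n-t}]^t\subset K(x)^n$ (column vectors with $s$ entries in $R$, $t-s$ in $xR$, $n-t$ in $x^2R$). *)

(* Defs.v *)
From HB Require Import structures.
From mathcomp Require Import all_boot all_order all_algebra fraction.
Set Implicit Arguments. Unset Strict Implicit. Unset Printing Implicit Defensive.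
Import Order.TTheory GRing.Theory Num.Theory.
Local Open Scope ring_scope.

(* Polygon vertices P_1..P_n are the naturals 1..n (counterclockwise).
   An edge (P_s,P_t) with s<t is the pair (s,t). *)
Definition edge := (nat * nat)%type.

Definition is_side (n : nat) (e : edge) : bool :=
  [&& (1 <= e.1)%N, e.1.+1 == e.2 & (e.2 <= n)%N] || (e == (1, n)%N).

Definition is_diag (n : nat) (e : edge) : bool :=
  [&& (1 <= e.1)%N, (e.1 < e.2)%N, (e.2 <= n)%N & ~~ is_side n e].

Definition crossing (e f : edge) : bool :=
  [&& (e.1 < f.1)%N, (f.1 < e.2)%N & (e.2 < f.2)%N]
  || [&& (f.1 < e.1)%N, (e.1 < f.2)%N & (f.2 < e.2)%N].

Definition is_triangulation (n : nat) (sigma : seq edge) : Prop :=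
  [/\ all (is_diag n) sigma,
      (forall e f, e \in sigma -> f \in sigma -> ~~ crossing e f) &
      (forall e, is_diag n e -> e \notin sigma ->
                 exists2 f, f \in sigma & crossing e f)].

Definition is_edge n (sigma : seq edge) (e : edge) : bool := is_side n e || (e \in sigma).

Definition edges n (sigma : seq edge) : seq edge :=
  [seq st <- [seq (s, t) | s <- iota 1 n, t <- iota 1 n]
     | (st.1 < st.2)%N && is_edge n sigma st].

Definition triangles n (sigma : seq edge) : seq (nat * nat * nat) :=
  [seq ijk <- flatten [seq [seq (i, j, k) | j <- iota 1 n, k <- iota 1 n]
                      | i <- iota 1 n]
     | [&& (ijk.1.1 < ijk.1.2)%N, (ijk.1.2 < ijk.2)%N,
          is_edge n (sigma : seq edge) (ijk.1.1, ijk.1.2), is_edge n sigma (ijk.1.2, ijk.2)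
        & is_edge n (sigma : seq edge) (ijk.1.1, ijk.2)]].

(* an arrow is (is_external, (source, target)) *)
Definition arrow := (bool * (edge * edge))%type.
Definition src (a : arrow) : edge := a.2.1.
Definition tgt (a : arrow) : edge := a.2.2.

(* internal arrows of the triangle i<j<k (counterclockwise):
   around P_i: (i,j)->(i,k); around P_k: (i,k)->(j,k); around P_j: (j,k)->(i,j) *)
Definition tri_arrows (t : nat * nat * nat) : seq arrow :=
  let: (i, j, k) := t in
  [:: (false, ((i, j), (i, k))); (false, ((i, k), (j, k)));
      (false, ((j, k), (i, j)))].

Definition ed (v w : nat) : edge := (minn v w, maxn v w).
Definition prevv (n v : nat) : nat := if v == 1%N then n else v.-1.
Definition nextv (n v : nat) : nat := if v == n then 1%N else v.+1.
Definition incident (sigma : seq edge) (v : nat) : bool :=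
  has (fun e : edge => (e.1 == v) || (e.2 == v)) sigma.

Definition ext_arrow (n v : nat) : arrow :=
  (true, (ed v (prevv n v), ed v (nextv n v))).

Definition arrows n (sigma : seq edge) : seq arrow :=
  flatten [seq tri_arrows t | t <- triangles n sigma]
  ++ [seq ext_arrow n v | v <- iota 1 n & incident sigma v].

(* a path: start vertex and list of arrows, composed left to right *)
Definition qpath := (edge * seq arrow)%type.

Fixpoint chain_ok (A : seq arrow) (v : edge) (s : seq arrow) : bool :=
  if s is a :: s' then [&& a \in A, src a == v & chain_ok A (tgt a) s']
  else true.

Definition valid n (sigma : seq edge) (p : qpath) : bool :=
  (p.1 \in edges n sigma) && chain_ok (arrows n sigma) p.1 p.2.

Definition pend (p : qpath) : edge := last p.1 (map tgt p.2).

(* elements of K Q_sigma are represented by formal sums of paths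
   (terms with invalid paths count as 0) *)
Definition fsum (K : fieldType) := seq (K * qpath)%type.

Definition coef (K : fieldType) n (sigma : seq edge) (u : fsum K) (p : qpath) : K :=
  \sum_(t <- u | (t.2 == p) && valid n sigma t.2) t.1.

Definition eqKQ (K : fieldType) n (sigma : seq edge) (u v : fsum K) : Prop :=
  forall p, coef n sigma u p = coef n sigma v p.

Definition fmul (K : fieldType) (u v : fsum K) : fsum K :=
  flatten [seq [seq (t.1 * t'.1, (t.2.1, t.2.2 ++ t'.2.2))
               | t' <- v & pend t.2 == t'.2.1] | t <- u].

Definition scale (K : fieldType) (k : K) (u : fsum K) : fsum K :=
  [seq (k * t.1, t.2) | t <- u].

Definition fsub (K : fieldType) (u v : fsum K) : fsum K := u ++ scale (-1) v.

Definition tri_cycle (t : nat * nat * nat) : qpath :=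
  ((t.1.1, t.1.2), tri_arrows t).

(* neighbours of P_v in counterclockwise order, starting at P_{v+1} *)
Definition nbrs n (sigma : seq edge) (v : nat) : seq nat :=
  [seq w <- [seq ((v.-1 + d) %% n).+1 | d <- iota 1 n.-1]
     | is_edge n (sigma : seq edge) (ed v w)].

Definition big_cycle n (sigma : seq edge) (v : nat) : qpath :=
  let es := map (ed v) (nbrs n sigma v) in
  (head (0, 0)%N es,
   [seq (false, p) | p <- zip es (behead es)] ++ [:: ext_arrow n v]).

Definition potential (K : fieldType) n (sigma : seq edge) : fsum K :=
  [seq (1, tri_cycle t) | t <- triangles n sigma]
  ++ [seq (-1, big_cycle n sigma v) | v <- iota 1 n & incident sigma v].

Definition deriv (K : fieldType) (a : arrow) (w : fsum K) : fsum K :=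
  flatten [seq [seq (t.1, (tgt a, behead (rot i t.2.2)))
               | i <- iota 0 (size t.2.2) & nth a t.2.2 i == a] | t <- w].

(* arrows with source or target not frozen (F = sides of P) *)
Definition gen_arrows n (sigma : seq edge) : seq arrow :=
  [seq a <- arrows n sigma | ~~ is_side n (src a) || ~~ is_side n (tgt a)].

Definition inJ (K : fieldType) n (sigma : seq edge) (u : fsum K) : Prop :=
  exists l : seq (K * qpath * arrow * qpath),
    all (fun x => x.1.2 \in gen_arrows n sigma) l /\
    eqKQ n sigma u
      (flatten [seq scale x.1.1.1
                  (fmul (fmul [:: (1, x.1.1.2)] (deriv x.1.2 (potential K n sigma)))
                        [:: (1, x.2)]) | x <- l]).

Definition Gequiv (K : fieldType) n (sigma : seq edge) (u v : fsum K) : Prop :=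
  inJ n (sigma : seq edge) (fsub u v).

Definition inT (K : fieldType) n (sigma : seq edge) (u : fsum K) : bool :=
  all (fun t => valid n sigma t.2 ==> is_side n t.2.1) u.

Definition inFGF (K : fieldType) n (sigma : seq edge) (u : fsum K) : bool :=
  all (fun t => valid n sigma t.2 ==> is_side n t.2.1 && is_side n (pend t.2)) u.

Definition unitF (K : fieldType) n (sigma : seq edge) : fsum K :=
  [seq (1, (e, [::])) | e <- edges n sigma & is_side n e].

Definition tri_of n (sigma : seq edge) (e : edge) : nat * nat * nat :=
  nth (0, 0, 0)%N [seq t <- triangles n (sigma : seq edge)
                   | has (fun a => src a == e) (tri_arrows t)] 0.

Definition cyc_at n (sigma : seq edge) (e : edge) : qpath :=
  let s := tri_arrows (tri_of n sigma e) in
  (e, rot (find (fun a => src a == e) s) s).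

Definition Celt (K : fieldType) n (sigma : seq edge) : fsum K :=
  [seq (1, cyc_at n sigma e) | e <- edges n sigma].

Definition tof (K : fieldType) (p : {poly K}) : {fraction {poly K}} :=
  @FracField.tofrac _ p.

Definition lat (K : fieldType) (c : int) (y : {fraction {poly K}}) : Prop :=
  exists p : {poly K}, y = (tof 'X) ^ c * tof p.

Definition cexp (n : nat) (i j : 'I_n) : int :=
  if (i <= j)%N then (if (i == 0%N :> nat) && (j == n.-1 :> nat) then -1 else 0)
  else if (i == j.+1 :> nat) then 1 else 2.

Definition inLam (K : fieldType) (n : nat) (A : 'M[{fraction {poly K}}]_n) : Prop :=
  forall i j : 'I_n, lat (cexp i j) (A i j).

(* exponent of row r (0-based) in the lattice (s,t) *)
Definition stexp (s t r : nat) : int :=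
  if (r.+1 <= s)%N then 0 else if (r.+1 <= t)%N then 1 else 2.

(* the direct sum of the (s,t), (s,t) running over edges n sigma:
   column k of M lies in the lattice (s,t) of the k-th edge *)
Definition inSum (K : fieldType) n (sigma : seq edge)
    (M : 'M[{fraction {poly K}}]_(n, size (edges n sigma))) : Prop :=
  forall (i : 'I_n) (k : 'I_(size (edges n sigma))),
    let e := nth (0, 0)%N (edges n sigma) k in lat (stexp e.1 e.2 i) (M i k).

(* phi : Lambda -> e_F Gamma e_F is an isomorphism of R-algebras
   (R acting on Gamma via x |-> C) *)
Definition is_Ralg_iso (K : fieldType) n (sigma : seq edge)
    (phi : 'M[{fraction {poly K}}]_n -> fsum K) : Prop :=
  ((forall A, inLam A -> inFGF n (sigma : seq edge) (phi A)) /\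
     (forall A B, inLam A -> inLam B ->
        Gequiv n (sigma : seq edge) (phi (A + B)) (phi A ++ phi B)) /\
     (forall A B, inLam A -> inLam B ->
        Gequiv n (sigma : seq edge) (phi (A *m B)) (fmul (phi A) (phi B))) /\
     (Gequiv n (sigma : seq edge) (phi 1%:M) (unitF K n sigma)) /\
     (forall (k : K) A, inLam A ->
        Gequiv n (sigma : seq edge) (phi (tof k%:P *: A)) (scale k (phi A))) /\
     (forall A, inLam A ->
        Gequiv n (sigma : seq edge) (phi (tof 'X *: A)) (fmul (Celt K n sigma) (phi A))) /\
     ((forall A B, inLam A -> inLam B -> Gequiv n (sigma : seq edge) (phi A) (phi B) -> A = B)) /\
     ((forall u, inFGF n sigma u -> exists2 A, inLam A & Gequiv n sigma u (phi A)))).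

(* psi : e_F Gamma -> (+)_(s,t) (s,t) is an isomorphism of Lambda-modules,
   Lambda acting on e_F Gamma through phi *)
Definition is_mod_iso (K : fieldType) n (sigma : seq edge)
    (phi : 'M[{fraction {poly K}}]_n -> fsum K)
    (psi : fsum K -> 'M[{fraction {poly K}}]_(n, size (edges n sigma))) : Prop :=
  ((forall u v, inT n sigma u -> inT n sigma v -> Gequiv n sigma u v -> psi u = psi v) /\
     (forall u, inT n sigma u -> inSum (psi u)) /\
     (forall u v, inT n sigma u -> inT n sigma v -> psi (u ++ v) = psi u + psi v) /\
     (forall A u, inLam A -> inT n sigma u -> psi (fmul (phi A) u) = A *m psi u) /\
     ((forall u v, inT n sigma u -> inT n sigma v -> psi u = psi v -> Gequiv n sigma u v)) /\
     ((forall M, inSum M -> exists2 u, inT n sigma u & psi u = M))).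

Definition is_Lam_endo (K : fieldType) n (sigma : seq edge)
    (phi : 'M[{fraction {poly K}}]_n -> fsum K) (f : fsum K -> fsum K) : Prop :=
  [/\ forall u, inT n sigma u -> inT n (sigma : seq edge) (f u),
      forall u v, inT n sigma u -> inT n sigma v -> Gequiv n sigma u v ->
        Gequiv n (sigma : seq edge) (f u) (f v),
      forall u v, inT n sigma u -> inT n sigma v ->
        Gequiv n (sigma : seq edge) (f (u ++ v)) (f u ++ f v) &
      forall A u, inLam A -> inT n sigma u ->
        Gequiv n (sigma : seq edge) (f (fmul (phi A) u)) (fmul (phi A) (f u))].

Arguments is_Lam_endo {K} n sigma phi f.

(* right multiplication Gamma^op -> End_Lambda(e_F Gamma), g |-> (u |-> u g),
   is well defined and bijective (it is multiplicative by associativity) *)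
Definition right_mult_iso (K : fieldType) n (sigma : seq edge)
    (phi : 'M[{fraction {poly K}}]_n -> fsum K) : Prop :=
  [/\ forall g : fsum K, is_Lam_endo n sigma phi (fun u => fmul u g),
      forall g g' : fsum K,
        (forall u, inT n sigma u -> Gequiv n (sigma : seq edge) (fmul u g) (fmul u g')) ->
        Gequiv n sigma g g' &
      forall f, is_Lam_endo n sigma phi f ->
        exists g : fsum K, forall u, inT n sigma u -> Gequiv n (sigma : seq edge) (f u) (fmul u g)].

Arguments is_Ralg_iso {K} n sigma phi.
Arguments is_mod_iso {K} n sigma phi psi.
Arguments right_mult_iso {K} n sigma phi.

(* Main.v *)
(** Give an arrow e -> f of the quiver the degree
    d(e, f) = max_r (c_r(f) - c_r(e)), where x^(c_r(e)) is the r-th exponent of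
    the lattice attached to e; this is 0 or 1.  Every relation is homogeneous, so
    sending a path p : e -> f to x^(deg p) maps Gamma onto the tiled order with
    exponents d(e, f), of which Lambda is the part indexed by the sides.
    Injectivity says that parallel paths of equal degree agree in Gamma.  An edge
    is the source of at most two arrows: two paths starting with the same arrow
    are compared by induction, and two paths starting with different arrows both
    factor, up to a single relation, through a common edge, because the target
    crosses no side of the triangles at hand.  The statement on endomorphisms
    follows from the fact that, for all e and f, some side c satisfies
    d(c, f) = d(c, e) + d(e, f). *)

(* The relations are homogeneous because every triangle and every big cycle has degree 1, so both
   terms of the derivative at an arrow c have degree 1 - deg c. An internal arrow lies in exactly
   one triangle and, if there is a diagonal at its pivot, in exactly one big cycle of the potential;
   each relation therefore identifies two paths.

   The inductions need a measure, since the quiver has cycles. Along every arrow the quantity e.1 +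
   e.2 + n * degree strictly increases, which bounds the length of the paths of given degree between
   two given edges.

   As elements of Gamma are formal sums modulo J, every later statement is tested on matrix entries:
   two sums are equivalent if and only if all their entries agree. For endomorphisms the difficulty
   is divisibility: the entries of the element g to be found must lie in the tiled order, and the
   side c of the overview is where this divisibility can be read off. *)
Require Import Defs.
From HB Require Import structures.
From mathcomp Require Import all_boot all_order all_algebra fraction.
From mathcomp Require Import zify ring.
From Stdlib Require Import ClassicalEpsilon.
Set Implicit Arguments. Unset Strict Implicit. Unset Printing Implicit Defensive.

(** * Degrees of paths *)

(* The least degree of a path from [e] to [f], namely the maximum over [r] of
   [stexp f.1 f.2 r - stexp e.1 e.2 r], when [e.1 < e.2] and [f.1 < f.2]. *)
Definition wd (e f : edge) : nat :=
  ~~ ((e.1 <= f.1) && (e.2 <= f.2)) + ~~ (e.1 <= f.2).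
Definition adeg (a : arrow) : nat := wd (src a) (tgt a).
Definition sdeg (s : seq arrow) : nat := sumn (map adeg s).

Lemma sdeg_cons a s : sdeg (a :: s) = adeg a + sdeg s.
Proof. by []. Qed.

Lemma sdeg_cat s t : sdeg (s ++ t) = sdeg s + sdeg t.
Proof. by rewrite /sdeg map_cat sumn_cat. Qed.

Lemma wd_refl e : e.1 < e.2 -> wd e e = 0.
Proof. rewrite /wd; lia. Qed.

Lemma wd_triangle e f g : e.1 < e.2 -> f.1 < f.2 -> g.1 < g.2 ->
  wd e g <= wd e f + wd f g.
Proof. rewrite /wd; lia. Qed.

(** The inequality [wd e f <= k] unfolded for each [k], so that a case split on [k] leaves linear
    arithmetic. *)
Definition reach (e f : edge) (k : nat) : bool :=
  match k with
  | 0 => (e.1 <= f.1) && (e.2 <= f.2)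
  | 1 => e.1 <= f.2
  | _ => true
  end.

Lemma wd_leE e f k : f.1 < f.2 -> (wd e f <= k) = reach e f k.
Proof. by case: k => [|[|k]]; rewrite /wd /=; lia. Qed.

Lemma edC v w : ed v w = ed w v.
Proof. by rewrite /ed minnC maxnC. Qed.

Lemma edE s t : s <= t -> ed s t = (s, t).
Proof. by move=> st; rewrite /ed (minn_idPl st) (maxn_idPr st). Qed.

Definition pathb (A : seq arrow) (e f : edge) (s : seq arrow) : bool :=
  chain_ok A e s && (last e (map tgt s) == f).

Lemma chain_ok_cat (A : seq arrow) e s t :
  chain_ok A e (s ++ t) = chain_ok A e s && chain_ok A (last e (map tgt s)) t.
Proof. by elim: s e => //= a s IH e; rewrite IH !andbA. Qed.

(** In a sorted list the strict order agrees with position, so adjacency means that nothing lies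
    between. This identifies the consecutive edges around a vertex. *)
Lemma mem_zip_behead (T : eqType) (r : rel T) (s : seq T) (x y : T) :
  transitive r -> irreflexive r -> sorted r s ->
  ((x, y) \in zip s (behead s)) =
  [&& x \in s, y \in s, r x y & all (fun z => ~~ (r x z && r z y)) s].
Proof.
move=> rT rI; case: s => // x0 s; elim: s => [|x1 s IH] in x0 *.
  by rewrite !inE => _; case: eqP => // ->; case: eqP => // ->; rewrite rI.
have -> : zip [:: x0, x1 & s] (behead [:: x0, x1 & s]) =
          (x0, x1) :: zip (x1 :: s) (behead (x1 :: s)) by [].
case/andP=> r01 ps; rewrite [LHS]in_cons (IH x1 ps) {IH} xpair_eqE.
have r0 z : z \in x1 :: s -> r x0 z.
  by rewrite inE => /predU1P[-> //|zs]; apply: (rT _ _ _ r01);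
    apply: (allP (order_path_min rT ps)).
have r1 z : z \in s -> r x1 z by move/(allP (order_path_min rT ps)).
apply/orP/and4P => [[/andP[/eqP-> /eqP->]|/and4P[xs ys rxy xyN]]|[xs ys rxy xyN]].
- rewrite !inE !eqxx orbT r01 /= !rI ?andbF /=; split=> //.
  apply/allP=> z zs; apply/negP => /andP[_ rz1].
  by have := rT _ _ _ (r1 _ zs) rz1; rewrite rI.
- rewrite !(in_cons x0) xs ys !orbT rxy; split=> //.
  apply/andP; split; last exact: xyN.
  by apply/negP=> /andP[rx0 _]; have := rT _ _ _ rx0 (r0 _ xs); rewrite rI.
have ys1 : y \in x1 :: s.
  move: ys; rewrite in_cons => /predU1P[ey|//]; move: xs rxy; rewrite in_cons ey.
  by case/predU1P=> [->|/r0 rx]; rewrite ?rI // => /(rT _ _ _ rx); rewrite rI.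
case/andP: xyN => x0N xyN.
move: xs; rewrite in_cons => /predU1P[ex|xs]; last by right; apply/and4P.
left; rewrite ex eqxx; move: ys1; rewrite in_cons => /predU1P[->|ys1]; first by rewrite eqxx.
by case/andP: xyN; rewrite ex r01 (r1 _ ys1).
Qed.

(** The cyclic order seen from [v]: going counterclockwise along the polygon from [v], one meets [w]
    before [w']. *)
Definition ccw (v w w' : nat) : bool :=
  [|| (v < w) && (w < w'), (w < w') && (w' < v) | (w' < v) && (v < w)].

Definition pivot_arrow (v w w' : nat) : arrow := (false, (ed v w, ed v w')).

Lemma ccw_trans v : transitive (ccw v).
Proof. by move=> y x z; rewrite /ccw; lia. Qed.

Lemma ccw_irr v : irreflexive (ccw v).
Proof. by move=> x; rewrite /ccw; lia. Qed.

Lemma ed_inj v : injective (ed v).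
Proof. by move=> w w' [] ; lia. Qed.

Lemma ed_meet v v' w w' x x' : ed v w = ed v' x -> ed v w' = ed v' x' ->
  w != w' -> v = v'.
Proof. by rewrite /ed => -[h1 h2] [h3 h4]; lia. Qed.

(** Turning around [v] costs degree 1 exactly when the far endpoint wraps from above [v] to below
    it. The additive form telescopes along a fan. *)
Lemma adeg_pivot v w w' : ccw v w w' ->
  adeg (pivot_arrow v w w') + (w < v) = (w' < v).
Proof. by rewrite /ccw /adeg /pivot_arrow /src /tgt /wd /ed /=; lia. Qed.

Definition fan (v : nat) (s : seq nat) : seq arrow :=
  [seq pivot_arrow v p.1 p.2 | p <- zip s (behead s)].

Lemma fan_cons v w w' s :
  fan v [:: w, w' & s] = pivot_arrow v w w' :: fan v (w' :: s).
Proof. by []. Qed.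

Lemma fan_tgt v w s : map tgt (fan v (w :: s)) = map (ed v) s.
Proof. by elim: s w => // w' s IH w; rewrite fan_cons !map_cons IH. Qed.

Lemma fan_src v w s : rcons (map src (fan v (w :: s))) (ed v (last w s)) = map (ed v) (w :: s).
Proof.
elim: s w => // w' s IH w; rewrite fan_cons !map_cons rcons_cons.
by congr (_ :: _); apply: IH.
Qed.

Lemma fan_chain (A : seq arrow) v w s : {subset fan v (w :: s) <= A} ->
  chain_ok A (ed v w) (fan v (w :: s)).
Proof.
elim: s w => // w' s IH w sA; rewrite fan_cons /= sA ?mem_head //= eqxx.
by apply: IH => a aF; apply: sA; rewrite fan_cons inE aF orbT.
Qed.

Lemma sdeg_fan v w s : path (ccw v) w s ->
  sdeg (fan v (w :: s)) + (w < v) = (last w s < v).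
Proof.
elim: s w => [|w' s IH] w //= /andP[cw /IH IHs].
by rewrite -IHs -(adeg_pivot cw) fan_cons sdeg_cons; lia.
Qed.

(** Isolates, in the derivative of the potential, the one triangle and the one big cycle that
    contain the given arrow. *)
Lemma flatten_map1 (S T : eqType) (F : S -> seq T) (s : seq S) x y :
  uniq s -> x \in s -> F x = [:: y] ->
  (forall z, z \in s -> z != x -> F z = [::]) ->
  flatten (map F s) = [:: y].
Proof.
move=> us xs Fx no; rewrite -[s](cat_take_drop (index x s)) (drop_index xs).
move: us no; rewrite -{1 2}[s](cat_take_drop (index x s)) (drop_index xs).
rewrite cat_uniq cons_uniq /= => /and4P[_ /norP[xt _] xd _] no.
have F0 s' : {subset s' <= take (index x s) s ++ x :: drop (index x s).+1 s} ->
    x \notin s' -> flatten (map F s') = [::].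
  elim: s' => //= z s' IH sub; rewrite inE negb_or => /andP[xz xs'].
  rewrite no ?sub ?mem_head 1?eq_sym // IH // => z' z's.
  by apply: sub; rewrite inE z's orbT.
rewrite map_cat flatten_cat /= !F0 ?Fx //.
- by move=> z zs; rewrite mem_cat inE zs !orbT.
- by move=> z zs; rewrite mem_cat zs.
Qed.

(** * Rotations and derivatives of cycles *)

Lemma rot_split (T : eqType) (c : T) s : c \in s ->
  exists s1 s2, s = s1 ++ c :: s2 /\ behead (rot (index c s) s) = s2 ++ s1.
Proof.
move=> cs; exists (take (index c s) s), (drop (index c s).+1 s).
by rewrite rot_index // -drop_index // cat_take_drop.
Qed.

Lemma chain_rot (A : seq arrow) e s c : chain_ok A e s -> last e (map tgt s) = e ->
  c \in s -> pathb A (tgt c) (src c) (behead (rot (index c s) s)).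
Proof.
move=> + + /rot_split[s1 [s2 [es ->]]]; rewrite es.
rewrite chain_ok_cat map_cat last_cat /= => /andP[h1 /and3P[_ /eqP sc h2]] le.
by rewrite /pathb chain_ok_cat map_cat last_cat h2 le h1 sc eqxx.
Qed.

Lemma sdeg_rot s c : c \in s -> adeg c + sdeg (behead (rot (index c s) s)) = sdeg s.
Proof.
by move/rot_split=> [s1 [s2 [-> ->]]]; rewrite !sdeg_cat sdeg_cons; lia.
Qed.

Lemma cycle_deriv (T : Type) (c : arrow) (s : seq arrow) (F : nat -> T) :
  uniq s -> [seq F i | i <- iota 0 (size s) & nth c s i == c] =
    if c \in s then [:: F (index c s)] else [::].
Proof.
move=> us; case: ifP => cs.
  rewrite (_ : filter _ _ = [:: index c s]) //.
  rewrite -(filter_pred1_uniq (iota_uniq 0 (size s))); last first.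
    by rewrite mem_iota /= add0n index_mem.
  apply: eq_in_filter => i; rewrite mem_iota /= add0n => i_s.
  by rewrite -{2}(nth_index c cs) nth_uniq // index_mem.
rewrite (_ : filter _ _ = [::]) //; apply/eqP; rewrite -[_ == _]negbK -has_filter.
apply/hasPn => i; rewrite mem_iota /= add0n => i_s.
by apply: contraFN cs => /eqP <-; apply: mem_nth.
Qed.

Lemma ccw_rot v w w' : ccw v w w' -> ccw w' v w && ccw w w' v.
Proof. by rewrite /ccw; lia. Qed.

(** The whole triangle has degree 1, and its third arrow, around [v], has degree 1 exactly when
    [w' < v < w]. *)
Lemma adeg_pivot2 v w w' : ccw v w w' ->
  adeg (pivot_arrow w' v w) + adeg (pivot_arrow w w' v) = ~~ ((w' < v) && (v < w)).
Proof.
move=> cw; have /andP[c1 c2] := ccw_rot cw.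
move: (adeg_pivot c1) (adeg_pivot c2) cw; rewrite /ccw.
move: (adeg _) (adeg _); clear; lia.
Qed.

Lemma wd_leE0 e f k : f.1 < f.2 -> (wd e f + 0 <= k) = reach e f k.
Proof. by move=> h; rewrite addn0 wd_leE. Qed.

Lemma wd_leE1 e f k : f.1 < f.2 -> (wd e f + 1 <= k) = (0 < k) && reach e f k.-1.
Proof. by move=> h; rewrite -wd_leE //; lia. Qed.

Lemma adeg0 s t s' t' : s <= s' -> t <= t' -> s <= t' -> adeg (false, ((s, t), (s', t'))) = 0.
Proof. by rewrite /adeg /wd /=; lia. Qed.

(** * Formal sums of paths *)

Section FormalSums.
Import GRing.Theory.
Local Open Scope ring_scope.
Variables (K : fieldType) (n : nat) (sigma : seq edge).
Implicit Types (u v w : fsum K) (p q : qpath).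
Local Notation A := (arrows n sigma).
Local Notation valid := (valid n sigma).
Local Notation coef := (coef n sigma).
Local Notation inJ := (inJ n sigma).

Lemma coef_nil p : coef ([::] : fsum K) p = 0.
Proof. by rewrite /Defs.coef big_nil. Qed.

Lemma coef_cons k q u p :
  coef ((k, q) :: u) p = k * ((q == p) && valid q)%:R + coef u p.
Proof.
rewrite /Defs.coef big_cons /=; case: ifP => _; first by rewrite mulr1.
by rewrite mulr0 add0r.
Qed.

Lemma coef_cat u v p : coef (u ++ v) p = coef u p + coef v p.
Proof. by rewrite /Defs.coef big_cat. Qed.

Lemma coef_scale k u p : coef (scale k u) p = k * coef u p.
Proof. by rewrite /Defs.coef big_map big_distrr. Qed.

Lemma inJ_eqKQ u v : eqKQ n sigma u v -> inJ v -> inJ u.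
Proof. by move=> uv [l [lg lv]]; exists l; split=> // p; rewrite uv. Qed.

Lemma inJ_nil : inJ ([::] : fsum K).
Proof. by exists [::]; split=> // p. Qed.

Lemma inJ_cat u v : inJ u -> inJ v -> inJ (u ++ v).
Proof.
move=> [l [lg lu]] [m [mg mv]]; exists (l ++ m); rewrite all_cat lg mg; split=> // p.
by rewrite map_cat flatten_cat !coef_cat lu mv.
Qed.

Lemma inJ_scale k u : inJ u -> inJ (scale k u).
Proof.
move=> [l [lg lu]].
exists [seq (k * x.1.1.1, x.1.1.2, x.1.2, x.2) | x <- l]; split=> [|p].
  by rewrite all_map; apply/allP => x /(allP lg).
rewrite coef_scale lu {lg lu}; elim: l => [|x l IH] /=; first by rewrite coef_nil mulr0.
by rewrite !coef_cat mulrDr IH !coef_scale mulrA.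
Qed.

Definition path_equiv p q : Prop := Gequiv n sigma [:: (1 : K, p)] [:: (1, q)].

Lemma path_equiv_refl p : path_equiv p p.
Proof.
apply: inJ_eqKQ inJ_nil => r.
by rewrite /fsub /= !coef_cons coef_nil; ring.
Qed.

Lemma path_equiv_sym p q : path_equiv p q -> path_equiv q p.
Proof.
move=> h; apply: inJ_eqKQ (inJ_scale (-1) h) => r.
by rewrite /fsub coef_scale /= !coef_cons coef_nil; ring.
Qed.

Lemma path_equiv_trans p q r : path_equiv p q -> path_equiv q r -> path_equiv p r.
Proof.
move=> h1 h2; apply: inJ_eqKQ (inJ_cat h1 h2) => x.
by rewrite /fsub coef_cat /= !coef_cons coef_nil; ring.
Qed.

(** A single generator of J, multiplied by [x] and [y], suffices. Validity of the composites need
    not be known, because invalid paths have coefficient 0. *)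
Lemma deriv_path_equiv (c : arrow) (r1 r2 : seq arrow) (e : edge) (x y : seq arrow) :
  c \in gen_arrows n sigma ->
  Defs.deriv c (potential K n sigma) = [:: (1, (tgt c, r1)); (-1, (tgt c, r2))] ->
  last e (map tgt x) = tgt c ->
  last (tgt c) (map tgt r1) = src c -> last (tgt c) (map tgt r2) = src c ->
  path_equiv (e, x ++ r1 ++ y) (e, x ++ r2 ++ y).
Proof.
move=> cg dE xe r1e r2e; exists [:: (1, (e, x), c, (src c, y))].
split; first by rewrite /= cg.
move=> p; rewrite /= dE /fmul /= /pend /= xe eqxx /=.
rewrite !map_cat !last_cat xe r1e r2e eqxx /= -!catA.
by rewrite !coef_cons !coef_nil /=; ring.
Qed.

End FormalSums.

(** * The matrix of a formal sum *)

Section Entries.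
Import GRing.Theory.
Local Open Scope ring_scope.
Variables (K : fieldType) (n : nat) (sigma : seq edge).
Implicit Types (u v w : fsum K) (p q : qpath) (e f : edge).
Local Notation A := (arrows n sigma).
Local Notation valid := (valid n sigma).

Definition joining e f p : bool := [&& valid p, p.1 == e & pend p == f].

Definition mx_entry u e f : {poly K} :=
  \sum_(t <- u | joining e f t.2) t.1 *: 'X^(sdeg t.2.2).

Lemma entry_nil e f : mx_entry [::] e f = 0.
Proof. by rewrite /mx_entry big_nil. Qed.

Lemma entry_cons t u e f :
  mx_entry (t :: u) e f = (joining e f t.2)%:R *: (t.1 *: 'X^(sdeg t.2.2)) + mx_entry u e f.
Proof. by rewrite /mx_entry big_cons; case: ifP; rewrite ?scale1r ?scale0r ?add0r. Qed.

Lemma entry_cat u v e f : mx_entry (u ++ v) e f = mx_entry u e f + mx_entry v e f.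
Proof. by rewrite /mx_entry big_cat. Qed.

Lemma entry_scale k u e f : mx_entry (scale k u) e f = k *: mx_entry u e f.
Proof.
by rewrite /mx_entry big_map scaler_sumr; apply: eq_bigr => t _; rewrite scalerA.
Qed.

Lemma entry_fsub u v e f : mx_entry (fsub u v) e f = mx_entry u e f - mx_entry v e f.
Proof. by rewrite entry_cat entry_scale scaleN1r. Qed.

Lemma entry_flatten (T : Type) (F : T -> fsum K) (s : seq T) e f :
  mx_entry (flatten (map F s)) e f = \sum_(x <- s) mx_entry (F x) e f.
Proof.
by elim: s => [|x s IH] /=; rewrite ?big_nil ?entry_nil // entry_cat big_cons IH.
Qed.

(** Regrouping repeated terms shows that entries depend on the coefficients alone. The list [S] is
    left free so that two sums can be compared over a common one. *)
Lemma entry_coefE u e f (S : seq qpath) : uniq S -> {subset map snd u <= S} ->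
  mx_entry u e f =
  \sum_(p <- S | joining e f p) coef n sigma u p *: 'X^(sdeg p.2).
Proof.
move=> uS; elim: u => [_|[k q] u IH sub].
  by rewrite entry_nil big1 // => p _; rewrite coef_nil scale0r.
have qS : q \in S by apply: sub; rewrite mem_head.
rewrite entry_cons IH; last by move=> p pu; apply: sub; rewrite inE pu orbT.
have -> : (joining e f q)%:R *: (k *: 'X^(sdeg q.2)) =
    \sum_(p <- S | joining e f p) (k * ((q == p) && valid q)%:R) *: 'X^(sdeg p.2) :> {poly K}.
  rewrite big_mkcond (bigD1_seq q) //= big1 ?addr0 => [|p /negPf npq].
    case: ifP => [/and3P[vq _ _]|_]; rewrite ?scale0r ?scale1r //.
    by rewrite eqxx vq mulr1.
  by rewrite eq_sym npq mulr0 scale0r if_same.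
by rewrite -big_split; apply: eq_bigr => p _; rewrite coef_cons scalerDl.
Qed.

Lemma entry_eqKQ u v e f : eqKQ n sigma u v -> mx_entry u e f = mx_entry v e f.
Proof.
move=> uv; set S := undup (map snd (u ++ v)).
have uS : uniq S by apply: undup_uniq.
rewrite (entry_coefE _ _ uS) ?(entry_coefE (u := v) _ _ uS).
- by apply: eq_bigr => p _; rewrite uv.
- by move=> p pv; rewrite mem_undup map_cat mem_cat pv orbT.
- by move=> p pv; rewrite mem_undup map_cat mem_cat pv.
Qed.

Lemma entry_filter (a b : pred edge) u e f :
  mx_entry [seq t <- u | a t.2.1 && b (pend t.2)] e f =
  if a e && b f then mx_entry u e f else 0.
Proof.
rewrite /mx_entry big_filter_cond; case: ifP => ab.
  apply: eq_bigl => t; rewrite /joining.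
  by case: eqP => [->|]; rewrite ?andbF //; case: eqP => [->|]; rewrite ?andbF // ab.
rewrite big_pred0 // => t; rewrite /joining.
by case: eqP => [->|]; rewrite ?andbF //; case: eqP => [->|]; rewrite ?andbF // ab.
Qed.

Lemma coef_entry u e f k :
  (mx_entry u e f)`_k = \sum_(t <- u | joining e f t.2 && (sdeg t.2.2 == k)) t.1.
Proof.
rewrite /mx_entry coef_sum [RHS]big_mkcondr; apply: eq_bigr => t _.
by rewrite coefZ coefXn eq_sym; case: eqP; rewrite ?mulr1 ?mulr0.
Qed.

Lemma coef_map_valid (g : qpath -> qpath) u p : valid p ->
  coef n sigma [seq (t.1, g t.2) | t <- u & valid t.2] p =
  \sum_(t <- u | valid t.2 && (g t.2 == p)) t.1.
Proof.
move=> vp; rewrite /coef big_map big_filter_cond; apply: eq_bigl => t /=.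
by case: eqP => [->|]; rewrite ?vp ?andbF.
Qed.

End Entries.

(** * Lattices and sides *)

Section Lattices.
Import Order.TTheory GRing.Theory Num.Theory.
Local Open Scope ring_scope.
Variable K : fieldType.
Implicit Types (p q : {poly K}) (c d : int) (y z : {fraction {poly K}}).
Local Notation xF := (tof 'X : {fraction {poly K}}).

Lemma tof_inj : injective (@tof K).
Proof. by move=> p q /eqP; rewrite /tof tofrac_eq => /eqP. Qed.

Lemma tofM p q : tof (p * q) = tof p * tof q.
Proof. exact: tofracM. Qed.

Lemma tofD p q : tof (p + q) = tof p + tof q.
Proof. exact: tofracD. Qed.

Lemma tof0 : tof 0 = 0 :> {fraction {poly K}}.
Proof. exact: tofrac0. Qed.

Lemma tof1 : tof 1 = 1 :> {fraction {poly K}}.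
Proof. exact: tofrac1. Qed.

Lemma tof_sum (I : Type) (r : seq I) (P : pred I) (F : I -> {poly K}) :
  tof (\sum_(i <- r | P i) F i) = \sum_(i <- r | P i) tof (F i).
Proof. exact: (big_morph _ tofD tof0). Qed.

Lemma xF_neq0 : xF != 0.
Proof. by rewrite /tof tofrac_eq0 polyX_eq0. Qed.

Lemma xFD c d : xF ^ (c + d) = xF ^ c * xF ^ d.
Proof. exact: expfzDr xF_neq0. Qed.

Lemma xF_tof c (m : nat) q : c = m -> xF ^ c * tof q = tof ('X^m * q).
Proof. by move->; rewrite tofM /tof tofracXn. Qed.

Lemma lat0 c : lat c (0 : {fraction {poly K}}).
Proof. by exists 0; rewrite tof0 mulr0. Qed.

Lemma latD c y z : lat c y -> lat c z -> lat c (y + z).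
Proof. by case=> p -> [q ->]; exists (p + q); rewrite tofD mulrDr. Qed.

Lemma latM c d y z : lat c y -> lat d z -> lat (c + d) (y * z).
Proof.
by case=> p -> [q ->]; exists (p * q); rewrite tofM xFD mulrACA.
Qed.

Lemma latS c d y : (c <= d)%R -> lat d y -> lat c y.
Proof.
move=> cd [p ->]; exists ('X^`|d - c|%N * p); rewrite tofM.
have dE : d = c + `|d - c|%N by lia.
by rewrite {1}dE xFD -mulrA /tof tofracXn.
Qed.

Lemma lat_sum c (I : Type) (r : seq I) (P : pred I) (F : I -> {fraction {poly K}}) :
  (forall i, P i -> lat c (F i)) -> lat c (\sum_(i <- r | P i) F i).
Proof. by move=> H; elim/big_ind: _ => //; [exact: lat0 | move=> *; exact: latD]. Qed.

Lemma lat_tofM c p y : lat c y -> lat c (tof p * y).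
Proof. by case=> q ->; exists (p * q); rewrite tofM mulrCA. Qed.

End Lattices.

(** * Sides as indices of the order *)

Section Sides.
Import Order.TTheory GRing.Theory Num.Theory.
Local Open Scope ring_scope.
Variable n : nat.
Implicit Types i j : 'I_n.

Definition side_of (i : 'I_n) : edge :=
  if i.+1 == n then (1%N, n) else (i.+1, i.+2).

(* The [j]-th column of the order is the lattice of the [j]-th side,
   rescaled by x^-1 when j is the last index; hence this correction. *)
Definition shift (i : 'I_n) : int := ((i.+1 == n) : nat)%:Z.

(** From row to row the exponents of [f] increase by at most 1, so the maximum defining the degree
    is attained in row [i], where the side has exponent [shift i]. *)
Lemma wd_side_of i (f : edge) :
  (3 <= n)%N -> (1 <= f.1 < f.2)%N -> (f.2 <= n)%N ->
  (wd (side_of i) f)%:Z = stexp f.1 f.2 i - shift i.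
Proof.
rewrite /side_of /shift /stexp /wd; have := ltn_ord i; case: f => s t /=.
case: eqP; case: ifP; try case: ifP; rewrite /=; lia.
Qed.

Lemma cexp_side_of i j : (3 <= n)%N ->
  cexp i j = stexp (side_of j).1 (side_of j).2 i - shift j.
Proof.
rewrite /side_of /shift /stexp /cexp; have := ltn_ord i; have := ltn_ord j.
have [ej|nej] := eqVneq j.+1 n => /=; repeat case: ifP; lia.
Qed.

Lemma side_of_inj : (3 <= n)%N -> injective side_of.
Proof.
move=> n3 i j; rewrite /side_of; have := ltn_ord i; have := ltn_ord j.
case: eqP => h; case: eqP => h' lj li e; apply: val_inj => /=;
  by move: (congr1 fst e) (congr1 snd e) => /=; lia.
Qed.

Lemma is_side_side_of i : (3 <= n)%N -> is_side n (side_of i).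
Proof.
move=> n3; rewrite /side_of /is_side; have := ltn_ord i.
by case: eqP => h li /=; rewrite ?eqxx ?orbT // ; apply/orP; left; lia.
Qed.

Lemma side_ofP (e : edge) : (3 <= n)%N -> is_side n e -> exists i, e = side_of i.
Proof.
case: e => s t n3; rewrite /is_side /= => /orP[/and3P[s1 /eqP <- sn]|/eqP[-> ->]].
  have si : (s.-1 < n)%N by lia.
  exists (Ordinal si); rewrite /side_of /= prednK //.
  by have -> : (s == n) = false by lia.
have ni : (n.-1 < n)%N by lia.
by exists (Ordinal ni); rewrite /side_of /= prednK ?eqxx //; lia.
Qed.

(** By [wd_side_of] the degree from a side reads off a single row, so it is enough to take the side
    whose row realizes the maximum in [wd e f]. *)
Lemma wd_attained (e f : edge) : (3 <= n)%N ->
  (1 <= e.1 < e.2)%N -> (e.2 <= n)%N -> (1 <= f.1 < f.2)%N -> (f.2 <= n)%N ->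
  exists c : 'I_n, wd (side_of c) f = (wd (side_of c) e + wd e f)%N.
Proof.
move=> n3 e1 e2 f1 f2.
(* Counted from 0, row [f.2] is the first where [f] has exponent 2 and row [f.1] the first where it
   has exponent 1; in row 0 both exponents vanish. *)
pose r := if (e.1 <= f.1)%N && (e.2 <= f.2)%N then 0%N
          else if (f.2 < e.2)%N then f.2 else f.1.
suff [rn H] : (r < n)%N /\ stexp f.1 f.2 r = stexp e.1 e.2 r + (wd e f)%:Z.
  by exists (Ordinal rn); have := @wd_side_of (Ordinal rn) f n3 f1 f2;
     have := @wd_side_of (Ordinal rn) e n3 e1 e2; rewrite /= H; lia.
case: e f e1 e2 f1 f2 @r => s t [s' t'] /=; rewrite /wd /stexp /=.
case: ifP => h1; [|case: ifP => h2]; split; try lia; repeat case: ifP; lia.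
Qed.

End Sides.

(** * Triangulations *)

Section Triangulation.
Variables (n : nat) (sigma : seq edge).
Hypotheses (n_ge3 : 3 <= n) (sigma_tri : is_triangulation n sigma).

Local Notation E := (is_edge n sigma).
Local Notation A := (arrows n sigma).

Lemma edge_range e : E e -> [&& 1 <= e.1, e.1 < e.2 & e.2 <= n].
Proof.
case: sigma_tri => /allP D _ _; rewrite /is_edge => /orP[|/D].
  by rewrite /is_side => /orP[|/eqP->] /=; lia.
by case/and4P=> -> -> ->.
Qed.

Lemma edges_nocross e f : E e -> E f -> ~~ crossing e f.
Proof.
move=> Ee Ef; have re := edge_range Ee; have rf := edge_range Ef.
have side_nc g h : is_side n g -> [&& 1 <= h.1, h.1 < h.2 & h.2 <= n] ->
    ~~ crossing g h && ~~ crossing h g.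
  case: g h => [a b] [c d]; rewrite /is_side /crossing /=.
  by case/orP => [|/eqP[-> ->]]; lia.
move: Ee Ef; rewrite /is_edge => /orP[/side_nc/(_ rf)/andP[]//|es].
case/orP=> [/side_nc/(_ re)/andP[]//|fs].
by case: sigma_tri => _ + _; apply.
Qed.

Lemma side_edge s t : 1 <= s -> t = s.+1 -> t <= n -> E (s, t).
Proof. by move=> h1 -> h2; rewrite /is_edge /is_side /= h1 h2 eqxx. Qed.

Lemma edge_1n : E (1, n).
Proof. by rewrite /is_edge /is_side eqxx orbT. Qed.

Lemma edge_nocross a b c d : E (a, b) -> E (c, d) ->
  ~~ ((a < c) && (c < b) && (b < d)).
Proof.
move=> h1 h2; have := edges_nocross h1 h2; rewrite /crossing /=; lia.
Qed.

Lemma nonedge_cross s t : 1 <= s -> s < t -> t <= n -> ~~ E (s, t) ->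
  exists x y, E (x, y) /\ ([&& s < x, x < t & t < y] \/ [&& x < s, s < y & y < t]).
Proof.
move=> s1 st tn; rewrite /is_edge negb_or => /andP[ns nin].
case: sigma_tri => _ _ /(_ (s, t)) [||[x y] fin].
- by rewrite /is_diag /= s1 st tn ns.
- by [].
rewrite /crossing /= => hc; exists x, y; split; first by rewrite /is_edge fin orbT.
by case/orP: hc => ?; [left|right].
Qed.

(** The longest edge from [s] ending before [t] gives the third vertex [w]: an edge crossing (w,t)
    but neither (s,w) nor (s,t) would start at [s] and be longer. *)
Lemma inner_triangle s t : E (s, t) -> s.+1 < t ->
  exists w, [/\ s < w, w < t, E (s, w) & E (w, t)].
Proof.
move=> Est st; have /and3P[/= s1 _ tn] := edge_range Est.
have exP : exists w, [&& s < w, w < t & E (s, w)].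
  by exists s.+1; rewrite side_edge //; lia.
have ub w : [&& s < w, w < t & E (s, w)] -> w <= t by lia.
case: (ex_maxnP exP ub) => w /and3P[sw wt Esw] wmax.
exists w; split=> //; case: (boolP (E (w, t))) => // nE.
have [|||x [y [Exy H]]] := nonedge_cross _ _ _ nE; try lia.
have := edge_nocross Esw Exy; have := edge_nocross Exy Esw.
have := edge_nocross Est Exy; have := edge_nocross Exy Est.
have [exs|] := eqVneq x s; last lia.
by move: (wmax y); rewrite -exs Exy; lia.
Qed.

(** If some edge from [s] ends beyond [t], the shortest such edge gives the third vertex. Otherwise
    [s > 1], because (1,n) is an edge, and the smallest [w] joined to [s] from below does; an edge
    crossing (w,t) would have to end or start at [s], and both are excluded. *)
Lemma outer_triangle s t : E (s, t) -> (s, t) != (1, n) ->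
  (exists w, [/\ t < w, E (s, w) & E (t, w)]) \/
  (exists w, [/\ w < s, E (w, s) & E (w, t)]).
Proof.
move=> Est st1; have /and3P[/= s1 st tn] := edge_range Est.
case: (boolP (has (fun w => (t < w) && E (s, w)) (iota 1 n))) => [/hasP[w0 _ w0P]|/hasPn no].
  left; have exP : exists w, (t < w) && E (s, w) by exists w0.
  case: (ex_minnP exP) => w /andP[tw Esw] wmin.
  have /and3P[/= _ _ wn] := edge_range Esw.
  exists w; split=> //; case: (boolP (E (t, w))) => // nE.
  have [|||x [y [Exy H]]] := nonedge_cross _ _ _ nE; try lia.
  have := edge_nocross Esw Exy; have := edge_nocross Exy Esw.
  have := edge_nocross Est Exy; have := edge_nocross Exy Est.
  have [exs|] := eqVneq x s; last lia.
  by move: (wmin y); rewrite -exs Exy; lia.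
right.
have nos w : t < w -> ~~ E (s, w).
  move=> tw; apply/negP => Esw; have /= := edge_range Esw => R.
  by have := no w; rewrite mem_iota tw Esw /=; lia.
have s_gt1 : 1 < s.
  rewrite ltn_neqAle s1 andbT eq_sym; apply/eqP => es.
  have := nos n; rewrite es edge_1n => h.
  by have et : t = n; [lia | rewrite es et eqxx in st1].
have exP : exists w, (w < s) && E (w, s).
  by exists s.-1; rewrite side_edge ?andbT; lia.
case: (ex_minnP exP) => w /andP[ws Ews] wmin.
have /and3P[/= w1 _ _] := edge_range Ews.
exists w; split=> //; case: (boolP (E (w, t))) => // nE.
have [|||x [y [Exy H]]] := nonedge_cross _ _ _ nE; try lia.
have := edge_nocross Ews Exy; have := edge_nocross Exy Ews.
have := edge_nocross Est Exy; have := edge_nocross Exy Est.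
have [exs|] := eqVneq x s.
  by move: (nos y); rewrite -exs Exy; lia.
have [eys|] := eqVneq y s; last lia.
by move: (wmin x); rewrite -eys Exy; lia.
Qed.

(** * Edges, triangles and arrows *)

Lemma mem_edges e : (e \in edges n sigma) = E e.
Proof.
rewrite /edges mem_filter; apply/andP/idP => [[/andP[]//]|Ee].
case: e Ee => s t Est; have /and3P[/= s1 st tn] := edge_range Est.
rewrite st Est; split=> //; apply/allpairsP; exists (s, t).
by rewrite !mem_iota /=; split=> //; lia.
Qed.

Lemma edges_uniq : uniq (edges n sigma).
Proof.
apply: filter_uniq; apply: allpairs_uniq; rewrite ?iota_uniq //.
by case=> a b [c d] _ _ [-> ->].
Qed.

Lemma mem_triangles i j k : ((i, j, k) \in triangles n sigma) =
  [&& i < j, j < k, E (i, j), E (j, k) & E (i, k)].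
Proof.
rewrite /triangles mem_filter /=; apply/andP/idP=> [[]//|H]; split=> //.
case/and5P: H => ij jk /edge_range/and3P[/= ? _ _] _ /edge_range/and3P[/= _ _ ?].
apply/flattenP; exists [seq (i, j0, k0) | j0 <- iota 1 n, k0 <- iota 1 n].
  by apply: map_f; rewrite mem_iota; lia.
apply/allpairsP; exists (j, k); rewrite /= !mem_iota; split=> //; lia.
Qed.

Lemma triangles_uniq : uniq (triangles n sigma).
Proof.
apply: filter_uniq.
set F := fun i : nat => _.
suff: forall s : seq nat, uniq s -> uniq (flatten (map F s)).
  by apply; rewrite iota_uniq.
elim=> //= i s IH /andP[nis us]; rewrite cat_uniq IH // andbT.
apply/andP; split.
  apply: allpairs_uniq; rewrite ?iota_uniq //.
  by case=> a b [c d] _ _ [-> ->].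
apply/hasPn => x /flattenP[_ /mapP[i' i's ->] /allpairsP[p [_ _ ->]]].
apply/negP => /allpairsP[q [_ _ [ei _ _]]].
by rewrite -ei i's in nis.
Qed.

Lemma arrowsP a : a \in arrows n sigma ->
  (exists2 t, t \in triangles n sigma & a \in tri_arrows t) \/
  (exists2 v, (1 <= v <= n) && incident sigma v & a = ext_arrow n v).
Proof.
rewrite mem_cat => /orP[/flattenP[_ /mapP[t tT ->] at_]|/mapP[v]].
  by left; exists t.
rewrite mem_filter mem_iota => /andP[iv rv] ->; right; exists v => //.
by rewrite iv; lia.
Qed.

Lemma arrows_tri t a : t \in triangles n sigma -> a \in tri_arrows t ->
  a \in arrows n sigma.
Proof.
move=> tT at_; rewrite mem_cat; apply/orP; left; apply/flattenP.
by exists (tri_arrows t) => //; apply: map_f.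
Qed.

Lemma arrows_ext v : 1 <= v -> v <= n -> incident sigma v ->
  ext_arrow n v \in arrows n sigma.
Proof.
move=> v1 vn iv; rewrite mem_cat; apply/orP; right; apply: map_f.
by rewrite mem_filter iv mem_iota; lia.
Qed.

Lemma triangle_arrows i j k :
  i < j -> j < k -> E (i, j) -> E (j, k) -> E (i, k) ->
  [/\ (false, ((i, j), (i, k))) \in arrows n sigma,
      (false, ((i, k), (j, k))) \in arrows n sigma &
      (false, ((j, k), (i, j))) \in arrows n sigma].
Proof.
move=> ij jk Eij Ejk Eik.
have tT : (i, j, k) \in triangles n sigma by rewrite mem_triangles ij jk Eij Ejk.
by split; apply: (arrows_tri tT); rewrite !inE eqxx ?orbT.
Qed.

Lemma arrow_edges a : a \in arrows n sigma -> E (src a) && E (tgt a).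
Proof.
case/arrowsP=> [[[[i j] k]]|[v /andP[rv _] ->]].
  rewrite mem_triangles => /and5P[ij jk Eij Ejk Eik].
  by rewrite !inE => /or3P[] /eqP-> /=; rewrite ?Eij ?Ejk ?Eik.
have ed_side x y : 1 <= x -> y = x.+1 -> y <= n -> E (ed x y).
  by move=> *; rewrite edE ?side_edge //; lia.
rewrite /ext_arrow /src /tgt /= /prevv /nextv.
have [->|v1] := eqVneq v 1.
  have [|_] := eqVneq 1 n; first lia.
  by rewrite edE ?edge_1n ?ed_side //; lia.
rewrite edC ed_side ?andTb; try lia.
have [->|vn] := eqVneq v n; last by rewrite ed_side //; lia.
by rewrite edC edE ?edge_1n //; lia.
Qed.

(** The measure behind all inductions on paths: an arrow of degree 0 raises the sum of the
    endpoints, and one of degree 1 lowers it by less than [n]. *)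
Lemma arrow_mass a : a \in arrows n sigma ->
  (src a).1 + (src a).2 < (tgt a).1 + (tgt a).2 + adeg a * n.
Proof.
move=> aA; have /andP[/edge_range + /edge_range] := arrow_edges aA.
case/arrowsP: aA => [[[[i j] k]]|[v /andP[rv _] ->]].
  rewrite mem_triangles !inE => /and5P[ij jk].
  move=> /edge_range/and3P[/= ? _ _] _ /edge_range/and3P[/= _ _ ?].
  by case/or3P => /eqP->; rewrite /adeg /src /tgt /= /wd /=; nia.
rewrite /adeg /ext_arrow /src /tgt /= /prevv /nextv.
have [->|v1] := eqVneq v 1.
  have [|_] := eqVneq 1 n; first lia.
  by rewrite !edE /wd /=; nia.
rewrite edC edE; last lia.
have [->|vn] := eqVneq v n; last by rewrite edE /wd /=; nia.
by rewrite edC edE /wd /=; nia.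
Qed.

(* The number is 0 for the arrow in the triangle on the inner side of the edge,
   1 for the one on the outer side, 2 for an external arrow. *)
Variant out_spec (s t : nat) : nat -> arrow -> Prop :=
| OutInner w of s < w & w < t & E (s, w) & E (w, t) :
    out_spec s t 0 (false, ((s, t), (w, t)))
| OutOuterR w of t < w & E (s, w) & E (t, w) :
    out_spec s t 1 (false, ((s, t), (s, w)))
| OutOuterL w of w < s & E (w, s) & E (w, t) :
    out_spec s t 1 (false, ((s, t), (w, s)))
| OutSide of 1 <= s & t = s.+1 & t < n & incident sigma t :
    out_spec s t 2 (true, ((s, t), (t, t.+1)))
| OutSideN of t = s.+1 & t = n & incident sigma n :
    out_spec s t 2 (true, ((s, t), (1, n)))
| OutLong of s = 1 & t = n & incident sigma 1 :
    out_spec s t 2 (true, ((s, t), (1, 2))).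

Lemma out_arrowP a s t : a \in A -> src a = (s, t) -> exists c, out_spec s t c a.
Proof.
case/arrowsP => [[[[i j] k]]|[v /andP[rv iv] ->]].
  rewrite mem_triangles => /and5P[ij jk Eij Ejk Eik].
  by rewrite !inE => /or3P[] /eqP-> [<- <-]; eexists; constructor; eassumption.
rewrite /ext_arrow /src /= /prevv /nextv.
have [ev|v1] := eqVneq v 1.
  rewrite ev in iv *; have [|_] := eqVneq 1 n; first lia.
  by rewrite !edE; try lia; move=> -[<- <-]; eexists; constructor.
rewrite edC edE; last lia.
have [ev|vn] := eqVneq v n.
  rewrite ev in iv *; rewrite [ed n 1]edC edE; last lia.
  by case=> <- <-; eexists; constructor=> //; lia.
rewrite edE; last lia.
by case=> <- <-; eexists; constructor=> //; lia.
Qed.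

Lemma ext_arrow_side s : 1 <= s -> s.+1 < n -> incident sigma s.+1 ->
  (true, ((s, s.+1), (s.+1, s.+2))) \in A.
Proof.
move=> s1 sn iv; have /= := arrows_ext (v := s.+1) isT _ iv.
rewrite /ext_arrow /prevv /nextv eqSS eqn_leq leqn0 [s == 0]eqn_leq leqn0.
have -> : (s.+1 == n) = false by lia.
have -> : (s == 0) = false by lia.
by rewrite /= edC !edE //; apply; lia.
Qed.

Lemma ext_arrow_sideN s : s.+1 = n -> incident sigma n ->
  (true, ((s, n), (1, n))) \in A.
Proof.
move=> sn iv; have := arrows_ext (v := n) _ _ iv.
rewrite /ext_arrow /prevv /nextv eqxx.
have -> : (n == 1) = false by lia.
have -> : n.-1 = s by lia.
by rewrite [ed n s]edC [ed n 1]edC !edE; try lia; apply; lia.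
Qed.

Lemma ext_arrow_long : incident sigma 1 -> (true, ((1, n), (1, 2))) \in A.
Proof.
move=> iv; have := arrows_ext (v := 1) _ _ iv.
rewrite /ext_arrow /prevv /nextv eqxx.
have -> : (1 == n) = false by lia.
by rewrite !edE; [apply; lia| lia | lia].
Qed.

Lemma nonincident_side x y : E (x, y) ->
  ~~ incident sigma x || ~~ incident sigma y -> is_side n (x, y).
Proof.
rewrite /is_edge => /orP[//|xys].
by case/orP => /hasPn/(_ _ xys); rewrite /= eqxx ?orbT.
Qed.

(** Suppose that every arrow leaving [e] loses [f]. These failures are inequalities between
    endpoints, and they contradict the fact that [f] crosses neither [e] nor the other sides of the
    triangles containing [e]. *)
Lemma reach_step e f k : E e -> E f -> wd e f <= k -> (e != f) || (0 < k) ->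
  exists2 a, a \in A & src a = e /\ wd (tgt a) f + adeg a <= k.
Proof.
case: e f => s t [s' t'] Est Ef.
have /and3P[/= s1 st tn] := edge_range Est.
have /and3P[/= s'1 s't' t'n] := edge_range Ef.
rewrite xpair_eqE wd_leE // => le_k ne.
suff /hasP[a aA /andP[/eqP sa ha]] :
  has (fun a => (src a == (s, t)) && (wd (tgt a) (s', t') + adeg a <= k)) A by exists a.
apply: contraT => /hasPn no.
have no0 b x' y' : (b, ((s, t), (x', y'))) \in A -> wd (s, t) (x', y') = 0 ->
    ~~ reach (x', y') (s', t') k.
  move=> /no + w0; rewrite /src /adeg /= eqxx w0 addn0 /=.
  by rewrite wd_leE.
have no1 b x' y' : (b, ((s, t), (x', y'))) \in A -> wd (s, t) (x', y') = 1 ->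
    (k == 0) || ~~ reach (x', y') (s', t') k.-1.
  move=> /no + w1; rewrite /src /adeg /= eqxx w1 addn1 /=.
  by case: (k) => //= m; rewrite ltnS wd_leE.
have {no}NC a b c d : E (a, b) -> E (c, d) -> ~~ crossing (a, b) (c, d).
  exact: edges_nocross.
have C0 := NC _ _ _ _ Est Ef.
have inner : s.+1 < t -> exists w, [/\ (s < w) && (w < t), E (s, w), E (w, t) &
    ~~ reach (w, t) (s', t') k].
  move=> h; have [w [sw wt Esw Ewt]] := inner_triangle Est h.
  exists w; split=> //; first by rewrite sw.
  have [_ /no0 h2 _] := triangle_arrows sw wt Esw Ewt Est.
  by apply: h2; rewrite /wd /=; lia.
have outer : (s, t) != (1, n) ->
  (exists w, [/\ t < w <= n, E (s, w), E (t, w) & ~~ reach (s, w) (s', t') k]) \/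
  (exists w, [/\ 0 < w < s, E (w, s), E (w, t) & (k == 0) || ~~ reach (w, s) (s', t') k.-1]).
  case/(outer_triangle Est) => -[w [h1 h2 h3]]; [left|right]; exists w.
    have /and3P[/= _ _ wn] := edge_range h2.
    split=> //; first by rewrite h1.
    have [/no0 h4 _ _] := triangle_arrows st h1 Est h3 h2.
    by apply: h4; rewrite /wd /=; lia.
  have /and3P[/= w1 _ _] := edge_range h2.
  split=> //; first by rewrite h1 w1.
  have [_ _ /no1 h4] := triangle_arrows h1 st h2 Est h3.
  by apply: h4; rewrite /wd /=; lia.
(* The side (1,n) has no outer triangle. Its second arrow is external if there is a diagonal at
   vertex 1; if not, the inner triangle contains the side (1,2). *)
have [[es et]|st1] := eqVneq (s, t) (1, n).
  have [|w [sw Esw Ewt rw]] := inner; first lia.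
  have [iv|ni] := boolP (incident sigma 1).
    have := no1 true 1 2; rewrite es et ext_arrow_long // => /(_ isT) H.
    have {H} : (k == 0) || ~~ reach (1, 2) (s', t') k.-1 by apply: H; rewrite /wd /=; lia.
    move: n_ge3 sw rw ne s'1 s't' t'n C0 (NC _ _ _ _ Esw Ef) (NC _ _ _ _ Ewt Ef) le_k.
    rewrite es et /crossing /reach /=; clear.
    by case: k => [|[|[|k]]] /=; lia.
  have := nonincident_side Esw; rewrite es ni => /(_ isT); rewrite /is_side xpair_eqE.
  move: n_ge3 sw rw ne s'1 s't' t'n C0 (NC _ _ _ _ Esw Ef) (NC _ _ _ _ Ewt Ef) le_k.
  rewrite es et /crossing /reach /=; clear.
  by case: k => [|[|[|k]]] /=; lia.
(* A diagonal has a triangle, hence an arrow, on each side. *)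
case: (ltnP s.+1 t) => [/inner[w [sw Esw Ewt rw]]|ts].
  case/outer: st1 => -[w' [h1 h2 h3 h4]].
    move: sw rw ne s'1 s't' t'n C0 (NC _ _ _ _ Esw Ef) (NC _ _ _ _ Ewt Ef) le_k.
    move: h1 (NC _ _ _ _ h2 Ef) (NC _ _ _ _ h3 Ef) h4.
    rewrite /crossing /reach /=; clear.
    by case: k => [|[|[|k]]] /=; lia.
  move: sw rw ne s'1 s't' t'n C0 (NC _ _ _ _ Esw Ef) (NC _ _ _ _ Ewt Ef) le_k.
  move: h1 (NC _ _ _ _ h2 Ef) (NC _ _ _ _ h3 Ef) h4.
  rewrite /crossing /reach /=; clear.
  by case: k => [|[|[|k]]] /=; lia.
have et : t = s.+1 by lia.
(* From here on [e] is a side (s,s+1), with an outer triangle only. Its external arrow turns around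
   [t], and for [t = n] it ends at (1,n) and has degree 1. *)
clear inner ts; have [tn'|tn'] := eqVneq t n.
  case/outer: st1 => -[w' [h1 h2 h3 h4]]; first lia.
  have [iv|ni] := boolP (incident sigma n).
    have := no1 true 1 n; rewrite tn' ext_arrow_sideN //; last lia.
    move=> /(_ isT) H.
    have {H} : (k == 0) || ~~ reach (1, n) (s', t') k.-1 by apply: H; rewrite /wd /=; lia.
    move: n_ge3 ne s'1 s't' t'n C0 le_k s1 et tn'.
    move: h1 (NC _ _ _ _ h2 Ef) (NC _ _ _ _ h3 Ef) h4.
    rewrite /crossing /reach /=; clear.
    by case: k => [|[|[|k]]] /=; lia.
  have := nonincident_side h3; rewrite tn' ni orbT => /(_ isT); rewrite /is_side xpair_eqE.
  move: n_ge3 ne s'1 s't' t'n C0 le_k s1 et tn'.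
  move: h1 (NC _ _ _ _ h2 Ef) (NC _ _ _ _ h3 Ef) h4.
  rewrite /crossing /reach /=; clear.
  by case: k => [|[|[|k]]] /=; lia.
have [iv|ni] := boolP (incident sigma t).
  have : ~~ reach (t, t.+1) (s', t') k.
    apply: (no0 true); last by rewrite /wd /=; lia.
    by rewrite et in iv tn' tn *; rewrite ext_arrow_side //; lia.
  case/outer: st1 => -[w' [h1 h2 h3 h4]].
    move: n_ge3 ne s'1 s't' t'n C0 le_k s1 et tn'.
    move: h1 (NC _ _ _ _ h2 Ef) (NC _ _ _ _ h3 Ef) h4.
    rewrite /crossing /reach /=; clear.
    by case: k => [|[|[|k]]] /=; lia.
  move: n_ge3 ne s'1 s't' t'n C0 le_k s1 et tn'.
  move: h1 (NC _ _ _ _ h2 Ef) (NC _ _ _ _ h3 Ef) h4.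
  rewrite /crossing /reach /=; clear.
  by case: k => [|[|[|k]]] /=; lia.
case/outer: st1 => -[w' [h1 h2 h3 h4]].
  have := nonincident_side h3; rewrite ni => /(_ isT); rewrite /is_side xpair_eqE.
  move: n_ge3 ne s'1 s't' t'n C0 le_k s1 et tn'.
  move: h1 (NC _ _ _ _ h2 Ef) (NC _ _ _ _ h3 Ef) h4.
  rewrite /crossing /reach /=; clear.
  by case: k => [|[|[|k]]] /=; lia.
have := nonincident_side h3; rewrite ni orbT => /(_ isT); rewrite /is_side xpair_eqE.
move: n_ge3 tn ne s'1 s't' t'n C0 le_k s1 et tn'.
move: h1 (NC _ _ _ _ h2 Ef) (NC _ _ _ _ h3 Ef) h4.
rewrite /crossing /reach /=; clear.
by case: k => [|[|[|k]]] /=; lia.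
Qed.

(** Keeps the truncated subtraction in the induction measure exact. *)
Lemma wd_mass e f k : E e -> E f -> wd e f <= k ->
  e.1 + e.2 <= f.1 + f.2 + k * n.
Proof.
move=> /edge_range/and3P[? ? ?] /edge_range/and3P[? ? ?]; rewrite wd_leE //.
by case: k => [|[|k]] /=; nia.
Qed.

(** [reach_step] is iterated; by [arrow_mass] the number [f.1 + f.2 + k * n - (e.1 + e.2)]
    decreases. All degrees from [wd e f] on are needed, one for each monomial. *)
Lemma path_exists e f k : E e -> E f -> wd e f <= k ->
  exists2 s, pathb A e f s & sdeg s = k.
Proof.
move: {2}(f.1 + f.2 + k * n - (e.1 + e.2)).+1 (ltnSn (f.1 + f.2 + k * n - (e.1 + e.2))) => m.
elim: m => // m IH in e k * => lt_m Ee Ef le_k.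
have [/andP[/eqP ef /eqP k0]|ne] := boolP ((e == f) && (k == 0)).
  by exists [::]; rewrite /pathb /= ?ef ?eqxx ?k0.
case: (reach_step Ee Ef le_k) => [|a aA [sa ra]]; first lia.
have /andP[_ Ea] := arrow_edges aA.
have mass := arrow_mass aA; rewrite sa in mass.
have ra' : wd (tgt a) f <= k - adeg a by lia.
have mass' := wd_mass Ea Ef ra'.
have le_ak : adeg a * n <= k * n by rewrite leq_mul2r; lia.
have [|s /andP[sP sE] sk] := IH (tgt a) (k - adeg a) _ Ea Ef ra'; last first.
- exists (a :: s); last by rewrite sdeg_cons sk; lia.
  by rewrite /pathb /= aA sa eqxx sP sE.
move: mass'; rewrite mulnBl; lia.
Qed.

(** * The cycle around a vertex *)

Lemma mem_nbrs v w : 1 <= v -> v <= n -> (w \in nbrs n sigma v) = E (ed v w).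
Proof.
move=> v1 vn; rewrite /nbrs mem_filter; case: (boolP (E _)) => //= Evw.
have := edge_range Evw; rewrite /ed /= => R.
apply/mapP; case: (ltnP v w) => vw.
  by exists (w - v); [rewrite mem_iota; lia | rewrite modn_small; lia].
exists (w + n - v); first by rewrite mem_iota; lia.
have -> : v.-1 + (w + n - v) = w.-1 + n by lia.
by rewrite modnDr modn_small; lia.
Qed.

Lemma nbrs_sorted v : 1 <= v -> v <= n -> sorted (ccw v) (nbrs n sigma v).
Proof.
move=> v1 vn; rewrite /nbrs; apply: sorted_filter; first exact: ccw_trans.
set f := fun d => _.
have fE d : 1 <= d -> d < n ->
    f d = v + d /\ v + d <= n \/ f d = v + d - n /\ n < v + d.
  move=> d1 dn; rewrite /f; case: (ltnP (v.-1 + d) n) => h.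
    by left; rewrite modn_small //; lia.
  have -> : v.-1 + d = (v.-1 + d - n) + n by lia.
  by right; rewrite modnDr modn_small; lia.
have fS d : 1 <= d -> d.+1 < n -> ccw v (f d) (f d.+1).
  move=> d1 dn; have := fE d d1 (ltnW dn); have := fE d.+1 isT dn.
  by rewrite /ccw; lia.
suff H k m : 1 <= m -> m + k <= n -> sorted (ccw v) (map f (iota m k)) by apply: H; lia.
elim: k => // -[//|k] IH in m * => m1 mk.
by apply/andP; split; [apply: fS; lia | apply: IH; lia].
Qed.

Lemma side_next v : 1 <= v -> v <= n -> is_side n (ed v (nextv n v)).
Proof.
move=> v1 vn; rewrite /nextv; have [->|vn'] := eqVneq v n.
  by rewrite edC edE /is_side ?eqxx ?orbT //; lia.
by rewrite edE // /is_side /= eqxx; apply/orP; left; lia.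
Qed.

Lemma side_prev v : 1 <= v -> v <= n -> is_side n (ed v (prevv n v)).
Proof.
move=> v1 vn; rewrite /prevv; have [->|vn'] := eqVneq v 1.
  by rewrite edE /is_side ?eqxx ?orbT //; lia.
by rewrite edC edE /is_side /=; lia.
Qed.

Lemma nbrs_head v : 1 <= v -> v <= n ->
  nbrs n sigma v = nextv n v :: behead (nbrs n sigma v).
Proof.
move=> v1 vn; rewrite /nbrs; have -> : n.-1 = n.-2.+1 by lia.
rewrite [iota _ _]/= [map _ _]/= addn1 prednK //.
have -> : (v %% n).+1 = nextv n v.
  rewrite /nextv; have [->|vn'] := eqVneq v n; first by rewrite modnn.
  by rewrite modn_small //; lia.
by rewrite [filter _ _]/= /is_edge side_next.
Qed.

Lemma nbrs_last v : 1 <= v -> v <= n -> last 0 (nbrs n sigma v) = prevv n v.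
Proof.
move=> v1 vn; rewrite /nbrs; have -> : n.-1 = n.-2 + 1 by lia.
rewrite iotaD map_cat filter_cat last_cat [iota _ 1]/= [map _ [:: _]]/=.
have -> : ((v.-1 + (1 + n.-2)) %% n).+1 = prevv n v.
  rewrite /prevv; have [->|vn'] := eqVneq v 1; first by rewrite modn_small; lia.
  have -> : v.-1 + (1 + n.-2) = v.-2 + n by lia.
  by rewrite modnDr modn_small; lia.
by rewrite [filter _ [:: _]]/= /is_edge side_prev.
Qed.

Lemma big_cycleE v : 1 <= v -> v <= n ->
  big_cycle n sigma v = (ed v (nextv n v), fan v (nbrs n sigma v) ++ [:: ext_arrow n v]).
Proof.
move=> v1 vn; rewrite /big_cycle; congr (_, _ ++ _); first by rewrite nbrs_head.
by rewrite /fan; elim: (nbrs n sigma v) => // w [|w' s] //= IH; congr (_ :: _).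
Qed.

Lemma pivot_arrow_in v w w' : E (ed v w) -> E (ed v w') -> E (ed w w') ->
  ccw v w w' -> pivot_arrow v w w' \in A.
Proof.
move=> Evw Evw' Eww'; rewrite /ccw /pivot_arrow => /or3P[] /andP[h1 h2].
- move: Evw Evw' Eww'; rewrite !edE; try lia.
  by move=> h3 h4 h5; case: (triangle_arrows h1 h2 h3 h5 h4).
- move: Evw Evw' Eww'; rewrite ![ed v _]edC !edE; try lia.
  by move=> h3 h4 h5; case: (triangle_arrows h1 h2 h5 h4 h3).
- move: Evw Evw' Eww'; rewrite ![ed _ w']edC !edE; try lia.
  by move=> h3 h4 h5; case: (triangle_arrows h1 h2 h4 h3 h5).
Qed.

(** If [w] and [w'] were not joined, some edge would cross their segment; crossing neither edge at
    [v], it would end at [v] between them. *)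
Lemma consecutive_edge v w w' : E (ed v w) -> E (ed v w') -> ccw v w w' ->
  (forall z, E (ed v z) -> ~~ (ccw v w z && ccw v z w')) -> E (ed w w').
Proof.
move=> Evw Evw' cw no; case: (boolP (E (ed w w'))) => // nE.
have Er x y : E (x, y) -> x = v -> ~~ (ccw v w y && ccw v y w').
  by move=> + ev; rewrite ev => Exy; apply: no; rewrite edE //; have /= := edge_range Exy; lia.
have El x y : E (x, y) -> y = v -> ~~ (ccw v w x && ccw v x w').
  by move=> + ev; rewrite ev => Exy; apply: no; rewrite edC edE //; have /= := edge_range Exy; lia.
case/or3P: (cw) => /andP[h1 h2].
- move: Evw Evw' nE; rewrite !edE; try lia; move=> Evw Evw' nE.
  have := edge_range Evw; have := edge_range Evw' => /= R R'.
  have [|||x [y [Exy H]]] := nonedge_cross _ _ _ nE; try lia.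
  move: (edge_nocross Evw Exy) (edge_nocross Evw' Exy) (edge_nocross Exy Evw')
    (Er _ _ Exy) H h1 h2; rewrite /ccw; clear; lia.
- move: Evw Evw' nE; rewrite ![ed v _]edC !edE; try lia; move=> Evw Evw' nE.
  have := edge_range Evw; have := edge_range Evw' => /= R R'.
  have [|||x [y [Exy H]]] := nonedge_cross _ _ _ nE; try lia.
  move: (edge_nocross Evw Exy) (edge_nocross Exy Evw) (edge_nocross Exy Evw')
    (El _ _ Exy) H h1 h2; rewrite /ccw; clear; lia.
- move: Evw Evw' nE; rewrite ![ed _ w']edC !edE; try lia; move=> Evw Evw' nE.
  have := edge_range Evw; have := edge_range Evw' => /= R R'.
  have [|||x [y [Exy H]]] := nonedge_cross _ _ _ nE; try lia.
  move: (edge_nocross Evw' Exy) (edge_nocross Evw Exy) (edge_nocross Exy Evw)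
    (edge_nocross Exy Evw') (El _ _ Exy) (Er _ _ Exy) H h1 h2; rewrite /ccw.
  clear; lia.
Qed.

Lemma fan_arrows v : 1 <= v -> v <= n -> {subset fan v (nbrs n sigma v) <= A}.
Proof.
move=> v1 vn a /mapP[[w w'] + ->].
rewrite (mem_zip_behead _ _ (@ccw_trans v) (@ccw_irr v)) ?nbrs_sorted //=.
rewrite !mem_nbrs // => /and4P[Ew Ew' cw /allP no].
apply: pivot_arrow_in => //; apply: consecutive_edge cw _ => // z.
by rewrite -mem_nbrs //; apply: no.
Qed.

(** An edge from [v] strictly between [w] and [w'] would cross the opposite side of the triangle, so
    the two are consecutive neighbours. *)
Lemma triangle_fan v w w' : E (ed v w) -> E (ed v w') -> E (ed w w') ->
  ccw v w w' -> pivot_arrow v w w' \in fan v (nbrs n sigma v).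
Proof.
move=> Ew Ew' Eww' cw; have := edge_range Ew; rewrite /ed /= => R.
have [v1 vn] : 1 <= v /\ v <= n by lia.
apply/mapP; exists (w, w') => //.
rewrite (mem_zip_behead _ _ (@ccw_trans v) (@ccw_irr v)) ?nbrs_sorted //=.
rewrite !mem_nbrs // Ew Ew' cw; apply/allP => z; rewrite mem_nbrs // => Ez.
move: (edges_nocross Ez Eww') cw (edge_range Ez).
by rewrite /ccw /crossing /ed /=; clear; lia.
Qed.

Lemma big_src v : 1 <= v -> v <= n ->
  map src (fan v (nbrs n sigma v) ++ [:: ext_arrow n v]) = map (ed v) (nbrs n sigma v).
Proof.
move=> v1 vn; rewrite map_cat.
have -> : map src [:: ext_arrow n v] = [:: ed v (prevv n v)] by [].
by rewrite -nbrs_last // nbrs_head // cats1 fan_src.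
Qed.

Lemma big_uniq v : 1 <= v -> v <= n ->
  uniq (fan v (nbrs n sigma v) ++ [:: ext_arrow n v]).
Proof.
move=> v1 vn; apply: (@map_uniq _ _ src); rewrite big_src //.
rewrite map_inj_uniq; last exact: ed_inj.
exact: (sorted_uniq (@ccw_trans v) (@ccw_irr v) (nbrs_sorted v1 vn)).
Qed.

Lemma big_chain v : 1 <= v -> v <= n -> incident sigma v ->
  chain_ok A (ed v (nextv n v)) (fan v (nbrs n sigma v) ++ [:: ext_arrow n v]).
Proof.
move=> v1 vn iv; have fA := fan_arrows v1 vn; move: (nbrs_last v1 vn) fA.
rewrite nbrs_head // => /= lN fA; rewrite chain_ok_cat fan_chain //=.
rewrite arrows_ext // fan_tgt andbT last_map lN.
by rewrite /ext_arrow /src /= eqxx.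
Qed.

(** For [1 < v < n] the degree comes from the fan, whose far endpoint wraps once from above [v] to
    below it. For [v = 1] and [v = n] the fan has degree 0 and the external arrow has degree 1. *)
Lemma sdeg_big v : 1 <= v -> v <= n ->
  sdeg (fan v (nbrs n sigma v) ++ [:: ext_arrow n v]) = 1.
Proof.
move=> v1 vn; move: (nbrs_last v1 vn) (nbrs_sorted v1 vn).
rewrite nbrs_head // => /= lN /sdeg_fan; rewrite lN sdeg_cat => H.
move: H; rewrite /sdeg /= addn0; move: (sumn _) => q.
rewrite /adeg /src /tgt /= /prevv /nextv.
have [e1|v1'] := eqVneq v 1; have [en|vn'] := eqVneq v n; rewrite /wd /ed /=; try lia.
Qed.

(** Removes the asymmetry of the ordering [i < j < k]: the cycle is rotated so that the chosen arrow
    comes first. *)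
Lemma arrow_pivot i j k c : i < j -> j < k -> c \in tri_arrows (i, j, k) ->
  E (i, j) -> E (j, k) -> E (i, k) ->
  exists v w w', [/\ ccw v w w', E (ed v w), E (ed v w'), E (ed w w') &
    c = pivot_arrow v w w' /\
    rot (index c (tri_arrows (i, j, k))) (tri_arrows (i, j, k)) =
      [:: pivot_arrow v w w'; pivot_arrow w' v w; pivot_arrow w w' v]].
Proof.
move=> ij jk + Eij Ejk Eik.
have e1 : ed i j = (i, j) by rewrite edE // ltnW.
have e2 : ed j k = (j, k) by rewrite edE // ltnW.
have e3 : ed i k = (i, k) by rewrite edE // ltnW // (ltn_trans ij).
have e1' := edC j i; have e2' := edC k j; have e3' := edC k i.
set a1 : arrow := (false, ((i, j), (i, k))).
set a2 : arrow := (false, ((i, k), (j, k))).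
set a3 : arrow := (false, ((j, k), (i, j))).
have ne12 : (a1 == a2) = false by apply/eqP => -[]; lia.
have ne13 : (a1 == a3) = false by apply/eqP => -[]; lia.
have ne23 : (a2 == a3) = false by apply/eqP => -[]; lia.
rewrite !inE => /or3P[]/eqP->.
- exists i, j, k; rewrite /ccw ij jk /pivot_arrow e1' e2' e3' e1 e2 e3.
  by split=> //=; rewrite !eqxx.
- exists k, i, j; rewrite /ccw ij jk ?orbT /pivot_arrow e1' e2' e3' e1 e2 e3.
  by split=> //=; rewrite -/a1 -/a2 -/a3 ne12 !eqxx.
- exists j, k, i; rewrite /ccw ij jk ?orbT /pivot_arrow e1' e2' e3' e1 e2 e3.
  by split=> //=; rewrite -/a1 -/a2 -/a3 ne13 ne23 !eqxx.
Qed.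

Lemma tri_arrow_inj t t' c : t \in triangles n sigma -> t' \in triangles n sigma ->
  c \in tri_arrows t -> c \in tri_arrows t' -> t = t'.
Proof.
case: t t' => [[i j] k] [[i' j'] k']; rewrite !mem_triangles.
move=> /and5P[h1 h2 _ _ _] /and5P[h3 h4 _ _ _]; rewrite !inE.
move=> /or3P[]/eqP-> /or3P[]/eqP; rewrite /src /tgt => -[]; intros; subst; try lia.
all: by [].
Qed.

Lemma tri_uniq i j k : i < j -> j < k -> uniq (tri_arrows (i, j, k)).
Proof.
move=> ij jk; apply: (@map_uniq _ _ src); rewrite /= !inE !xpair_eqE /src /=; lia.
Qed.

(** Distinct edges share at most one polygon vertex, so the arrow determines its pivot. *)
Lemma pivot_in_big v w w' v' : w != w' ->
  pivot_arrow v w w' \in fan v' (nbrs n sigma v') ++ [:: ext_arrow n v'] -> v = v'.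
Proof.
move=> ww; rewrite mem_cat inE orbF => /mapP[[x x'] _ [h1 h2 h3 h4]].
have e1 : ed v w = ed v' x by rewrite /ed h1 h2.
have e2 : ed v w' = ed v' x' by rewrite /ed h3 h4.
exact: ed_meet e1 e2 ww.
Qed.

(** * Parallel paths of equal degree *)

Section Algebra.
Import GRing.Theory.
Local Open Scope ring_scope.
Variable K : fieldType.

Lemma pivot_triangle v w w' : ccw v w w' ->
  E (ed v w) -> E (ed v w') -> E (ed w w') ->
  exists2 t, t \in triangles n sigma & pivot_arrow v w w' \in tri_arrows t /\
    rot (index (pivot_arrow v w w') (tri_arrows t)) (tri_arrows t) =
      [:: pivot_arrow v w w'; pivot_arrow w' v w; pivot_arrow w w' v].
Proof.
move=> cw Ew Ew' Eww'; have cA := pivot_arrow_in Ew Ew' Eww' cw.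
have ww' : w != w' by move: cw; rewrite /ccw; lia.
case/arrowsP: cA => [[t tT ct]|[x _ ]]; last by [].
exists t => //; split=> //; case: t => [[i j] k] in tT ct *.
move: (tT); rewrite mem_triangles => /and5P[ij jk Eij Ejk Eik].
have [x [y [y' [_ _ _ _ [cE ->]]]]] := arrow_pivot ij jk ct Eij Ejk Eik.
case: (cE) => h1 h2 h3 h4.
have e1 : ed v w = ed x y by rewrite /ed h1 h2.
have e2 : ed v w' = ed x y' by rewrite /ed h3 h4.
have vx := ed_meet e1 e2 ww'; subst x.
by rewrite (ed_inj e1) (ed_inj e2).
Qed.

Lemma diag_incident v w : E (ed v w) -> ~~ is_side n (ed v w) -> incident sigma v.
Proof.
rewrite /is_edge => /orP[->//|es] _; apply/hasP; exists (ed v w) => //=.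
by rewrite /minn /maxn; case: ltnP => _; rewrite eqxx ?orbT.
Qed.

(** External arrows join two sides, so relations come from internal arrows only. One end of such an
    arrow is a diagonal at the pivot [v], and hence the big cycle at [v] belongs to the
    potential. *)
Lemma gen_arrow_pivot c : c \in gen_arrows n sigma ->
  exists v w w', [/\ ccw v w w', E (ed v w), E (ed v w'), E (ed w w') &
    incident sigma v /\ c = pivot_arrow v w w'].
Proof.
rewrite mem_filter => /andP[cS] /arrowsP[[[[i j] k]]|[v /andP[rv iv] cE]].
  rewrite mem_triangles => /and5P[ij jk Eij Ejk Eik] ct.
  have [v [w [w' [h1 h2 h3 h4 [cE _]]]]] := arrow_pivot ij jk ct Eij Ejk Eik.
  exists v, w, w'; split=> //; split=> //.
  by move: cS; rewrite cE => /orP[]; apply: diag_incident.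
by move: cS; rewrite cE /ext_arrow /src /tgt /= side_prev ?side_next //; lia.
Qed.

Lemma pivot_gen v w w' : ccw v w w' -> E (ed v w) -> E (ed v w') -> E (ed w w') ->
  ~~ is_side n (ed v w) || ~~ is_side n (ed v w') ->
  pivot_arrow v w w' \in gen_arrows n sigma.
Proof. by move=> *; rewrite mem_filter pivot_arrow_in // andbT. Qed.

Lemma deriv_pivot v w w' : ccw v w w' ->
  E (ed v w) -> E (ed v w') -> E (ed w w') -> incident sigma v ->
  let c := pivot_arrow v w w' in
  let B := fan v (nbrs n sigma v) ++ [:: ext_arrow n v] in
  Defs.deriv c (potential K n sigma) =
    [:: (1, (tgt c, [:: pivot_arrow w' v w; pivot_arrow w w' v]));
        (-1, (tgt c, behead (rot (index c B) B)))].
Proof.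
move=> cw Ew Ew' Eww' iv c B.
have ww' : w != w' by move: cw; rewrite /ccw; lia.
have R := edge_range Ew; have R' := edge_range Ew'.
have [v1 vn] : (1 <= v /\ v <= n)%N by move: R; rewrite /ed /=; lia.
have [t tT [ct rt]] := pivot_triangle cw Ew Ew' Eww'.
rewrite /Defs.deriv /potential map_cat flatten_cat -!map_comp.
rewrite (@flatten_map1 _ _ _ _ t (1, (tgt c, [:: pivot_arrow w' v w; pivot_arrow w w' v]))).
- rewrite (@flatten_map1 _ _ _ _ v (-1, (tgt c, behead (rot (index c B) B)))) //.
  + by rewrite filter_uniq ?iota_uniq.
  + by rewrite mem_filter iv mem_iota; lia.
  + rewrite /comp big_cycleE //; cbn [fst snd]; rewrite cycle_deriv ?big_uniq // mem_cat.
    by rewrite triangle_fan.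
  move=> z; rewrite mem_filter mem_iota => /andP[_ zn] zv.
  have [z1 zn'] : (1 <= z /\ z <= n)%N by lia.
  rewrite /comp big_cycleE //; cbn [fst snd]; rewrite cycle_deriv ?big_uniq //; case: ifP => // cB.
  by rewrite (pivot_in_big ww' cB) eqxx in zv.
- exact: triangles_uniq.
- by [].
- case: t tT ct rt => [[i j] k] tT ct rt; move: (tT).
  rewrite mem_triangles => /and5P[ij jk _ _ _].
  by rewrite /comp; cbn [fst snd tri_cycle]; rewrite cycle_deriv ?tri_uniq // ct rt.
case=> [[i j] k] zT zt; move: (zT); rewrite mem_triangles => /and5P[ij jk _ _ _].
rewrite /comp; cbn [fst snd tri_cycle]; rewrite cycle_deriv ?tri_uniq //; case: ifP => // cz.
by rewrite (tri_arrow_inj zT tT cz ct) eqxx in zt.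
Qed.

(** The edge joins the two neighbours of [v] on the polygon, so a diagonal at [v] would cross it. *)
Lemma incident_nocross v w w' : incident sigma v -> E (w, w') ->
  [|| (v == w.+1) && (w' == v.+1), [&& v == 1, w == 2 & w' == n]%N |
   [&& v == n, w == 1 & w'.+1 == n]%N] -> False.
Proof.
case/hasP => -[x y] xys xv Eww.
have Exy : E (x, y) by rewrite /is_edge xys orbT.
case: sigma_tri => /allP/(_ _ xys) + _ _.
have /= := edge_range Exy; have /= := edge_range Eww.
move: (edge_nocross Eww Exy) (edge_nocross Exy Eww) xv n_ge3.
rewrite /is_diag /is_side xpair_eqE /=; clear; lia.
Qed.

(** Two triangles on the same side of an edge would have crossing edges; this also excludes that
    both shapes of outer triangle occur. *)
Lemma out_spec_inj s t c d a b : E (s, t) -> out_spec s t c a -> out_spec s t d b -> c = d -> a = b.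
Proof.
move=> /edge_range/and3P[/= s1 st tn].
have X w1 w2 w3 w4 : E (w1, w2) -> E (w3, w4) -> (w1 < w3 < w2)%N -> (w2 < w4)%N -> False.
  by move=> h1 h2 h3 h4; have := edge_nocross h1 h2; lia.
case=> [w h1 h2 h3 h4|w h1 h2 h3|w h1 h2 h3|h1 h2 h3 h4|h1 h2 h3|h1 h2 h3];
  case=> [w' k1 k2 k3 k4|w' k1 k2 k3|w' k1 k2 k3|k1 k2 k3 k4|k1 k2 k3|k1 k2 k3] // _.
- suff -> : w = w' by [].
  by case: (ltngtP w w') => // h; [case: (X _ _ _ _ k3 h4) | case: (X _ _ _ _ h3 k4)]; lia.
- suff -> : w = w' by [].
  by case: (ltngtP w w') => // h; [case: (X _ _ _ _ h2 k3) | case: (X _ _ _ _ k2 h3)]; lia.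
- by case: (X _ _ _ _ k3 h2); have := edge_range k2; rewrite /=; lia.
- by case: (X _ _ _ _ h3 k2); have := edge_range h2; rewrite /=; lia.
- suff -> : w = w' by [].
  by case: (ltngtP w w') => // h; [case: (X _ _ _ _ h2 k3) | case: (X _ _ _ _ k2 h3)]; lia.
all: lia.
Qed.

(** An edge with triangles on both sides is a diagonal, whereas external arrows leave from sides. *)
Lemma out_spec_three s t a b c : E (s, t) ->
  out_spec s t 0 a -> out_spec s t 1 b -> out_spec s t 2 c -> False.
Proof.
move=> /edge_range/and3P[/= s1 st tn] Ha Hb Hc; have [] : (s.+1 < t)%N /\ (s, t) != (1, n)%N.
  split.
    by case: {-1}_ {-1}_ / Ha (erefl 0%N) => //; lia.
  case: {-1}_ {-1}_ / Hb (erefl 1%N) => // w h1 h2 h3 _; rewrite xpair_eqE;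
   have := edge_range h2; have := edge_range h3; rewrite /=; lia.
rewrite xpair_eqE.
by case: {-1}_ {-1}_ / Hc (erefl 2%N) => //; lia.
Qed.

(* The relation of the arrow from [ed v w] to [e] equates two paths from [e] to
   [ed v w], one starting with [a] and the other with [b], and [f] can still be
   reached from [ed v w] within degree [k]. *)
Definition merging (e f : edge) (k : nat) (a b : arrow) : Prop :=
  exists v w w', [/\ ccw v w w', E (ed v w), E (ed v w'), E (ed w w') &
    [/\ ~~ is_side n (ed v w) || ~~ is_side n (ed v w'), ed v w' = e,
        pivot_arrow w' v w = a \/ pivot_arrow w' v w = b &
        (wd (ed v w) f + (adeg (pivot_arrow w' v w) + adeg (pivot_arrow w w' v)) <= k)%N]].

(** At a diagonal, the inner and the outer triangle each offer a relation; if the outer one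
    overshoots [f], the inner one does not, because [f] crosses no side of the two triangles. At a
    side, the only triangle offers the relation, and the edge where its arrow starts is a diagonal:
    otherwise the third side would cut off the vertex of the external arrow, against
    [incident_nocross]. *)
Lemma out_spec_merging s t f k c d a b : E (s, t) -> E f ->
  out_spec s t c a -> out_spec s t d b -> (c < d)%N ->
  (wd (tgt a) f + adeg a <= k)%N -> (wd (tgt b) f + adeg b <= k)%N ->
  merging (s, t) f k a b.
Proof.
case: f => s' t' Est Ef Ha Hb.
have /and3P[/= s1 st tn] := edge_range Est.
have /and3P[/= s'1 s't' t'n] := edge_range Ef.
have NC x y : E (x, y) -> ~~ crossing (x, y) (s', t') by move=> h; apply: edges_nocross.
have M v w w' : ccw v w w' -> E (ed v w) -> E (ed v w') -> E (ed w w') ->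
    ~~ is_side n (ed v w) || ~~ is_side n (ed v w') -> ed v w' = (s, t) ->
    pivot_arrow w' v w = a \/ pivot_arrow w' v w = b ->
    (wd (ed v w) (s', t') + ~~ ((w' < v) && (v < w)) <= k)%N ->
    merging (s, t) (s', t') k a b.
  by move=> h1 h2 h3 h4 h5 h6 h7 h8; exists v, w, w'; rewrite adeg_pivot2.
(* The inner triangle merges at its arrow into [(s, t)] around [s]. *)
have Minner w : (s < w)%N -> (w < t)%N -> E (s, w) -> E (w, t) ->
    ~~ is_side n (s, w) || ~~ is_side n (s, t) ->
    (false, ((s, t), (w, t))) = a ->
    (0 < k)%N && reach (s, w) (s', t') k.-1 -> merging (s, t) (s', t') k a b.
  move=> sw wt Esw Ewt ns ea r1; apply: (M s w t).
  - by rewrite /ccw sw wt.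
  - by rewrite edE // ltnW.
  - by rewrite edE // ltnW.
  - by rewrite edE // ltnW.
  - by rewrite !edE // ltnW.
  - by rewrite edE // ltnW.
  - by left; rewrite /pivot_arrow ![ed t _]edC !edE // ltnW.
  by rewrite edE ?(ltnW sw) // ltnNge (ltnW st) wd_leE1.
(* The outer triangle merges at its arrow into [(s, t)] around [t]. *)
have MouterR w x : (t < w)%N -> E (s, w) -> E (t, w) ->
    ~~ is_side n (t, w) || ~~ is_side n (s, t) ->
    (x = a \/ x = b) -> (false, ((s, t), (s, w))) = x ->
    reach (t, w) (s', t') k -> merging (s, t) (s', t') k a b.
  move=> tw Esw Etw ns xab ex r1; apply: (M t w s).
  - by rewrite /ccw st tw !orbT.
  - by rewrite edE // ltnW.
  - by rewrite edC edE // ltnW.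
  - by rewrite edC edE // ltnW // (ltn_trans st).
  - by rewrite (edC t s) !edE // ltnW.
  - by rewrite edC edE // ltnW.
  - by rewrite /pivot_arrow !edE ?ex // ltnW // (ltn_trans st).
  by rewrite edE ?(ltnW tw) // st tw wd_leE0.
(* The pivot is again [t], but the two arrows following (s,t) now have total degree 1 instead of
   0. *)
have MouterL w x : (w < s)%N -> E (w, s) -> E (w, t) ->
    ~~ is_side n (w, t) || ~~ is_side n (s, t) ->
    (x = a \/ x = b) -> (false, ((s, t), (w, s))) = x ->
    (0 < k)%N && reach (w, t) (s', t') k.-1 -> merging (s, t) (s', t') k a b.
  move=> ws Ews Ewt ns xab ex r1; have wt := ltn_trans ws st; apply: (M t w s).
  - by rewrite /ccw ws st !orbT.
  - by rewrite edC edE // ltnW.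
  - by rewrite edC edE // ltnW.
  - by rewrite edE // ltnW.
  - by rewrite !(edC t) !edE // ltnW.
  - by rewrite edC edE // ltnW.
  - by rewrite /pivot_arrow (edC s w) !edE ?ex // ltnW.
  by rewrite edC edE ?(ltnW wt) // [(t < w)%N]ltnNge (ltnW wt) andbF wd_leE1.
case: Ha M Minner MouterR MouterL =>
  [w h1 h2 h3 h4|w h1 h2 h3|w h1 h2 h3|h1 h2 h3 h4|h1 h2 h3|h1 h2 h3] _;
  case: Hb => [w' k1 k2 k3 k4|w' k1 k2 k3|w' k1 k2 k3|k1 k2 k3 k4|k1 k2 k3|k1 k2 k3] // MI MR ML _.
- rewrite !adeg0 ?wd_leE0 //; try lia; rewrite /tgt /= => ra rb.
  have /= R := edge_range k3.
  have ns : ~~ is_side n (s, t) by rewrite /is_side xpair_eqE /=; lia.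
  have [r1|r1] := boolP (reach (t, w') (s', t') k).
    by apply: (MR w' _ k1 k2 k3 _ (or_intror erefl)); rewrite ?ns ?orbT.
  apply: (MI w); rewrite ?ns ?orbT //.
  move: (NC _ _ Est) (NC _ _ h3) (NC _ _ h4) (NC _ _ k2) (NC _ _ k3) ra rb r1 h1 h2 k1 s'1 s't'.
  by rewrite /crossing /reach /=; clear; case: k => [|[|[|k]]] /=; lia.
- rewrite adeg0; try lia; have -> : adeg (false, (s, t, (w', s))) = 1%N.
    by rewrite /adeg /wd /=; lia.
  rewrite wd_leE0 // wd_leE1 // /tgt /= => ra rb.
  have /= R := edge_range k3.
  have ns : ~~ is_side n (s, t) by rewrite /is_side xpair_eqE /=; have /= := edge_range k2; lia.
  have [r1|r1] := boolP ((0 < k)%N && reach (w', t) (s', t') k.-1).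
    by apply: (ML w' _ k1 k2 k3 _ (or_intror erefl)); rewrite ?ns ?orbT.
  apply: (MI w); rewrite ?ns ?orbT //.
  move: (NC _ _ Est) (NC _ _ h3) (NC _ _ h4) (NC _ _ k2) (NC _ _ k3) ra rb r1 h1 h2 k1 s'1 s't'.
  by rewrite /crossing /reach /=; clear; case: k => [|[|[|k]]] /=; lia.
- by lia.
- by lia.
- have -> : adeg (true, (s, t, (1, 2)%N)) = 1%N by rewrite /adeg /wd /=; lia.
  rewrite adeg0 ?wd_leE0 ?wd_leE1 //; try lia; rewrite /tgt /= => ra rb.
  apply: (MI w) => //.
    apply/orP; left; apply/negP; rewrite /is_side xpair_eqE k1 /= => sw.
    by apply: (incident_nocross k3 h4); lia.
  move: (NC _ _ Est) (NC _ _ h3) (NC _ _ h4) ra rb h1 h2 s'1 s't' k1.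
  by rewrite /crossing /reach /=; clear; case: k => [|[|[|k]]] /=; lia.
- rewrite !adeg0 ?wd_leE0 //; try lia.
  have -> : adeg (true, (s, t, (t, t.+1))) = 0%N by rewrite /adeg /wd /=; lia.
  rewrite wd_leE0 // /tgt /= => ra rb.
  apply: (MR w _ h1 h2 h3 _ (or_introl erefl)) => //.
    apply/orP; left; apply/negP; rewrite /is_side xpair_eqE /= => tw.
    by apply: (incident_nocross k4 h2); have /= := edge_range h2; lia.
  move: (NC _ _ Est) (NC _ _ h2) (NC _ _ h3) ra rb h1 s'1 s't' k2.
  by rewrite /crossing /reach /=; clear; case: k => [|[|[|k]]] /=; lia.
- by have /= := edge_range h2; lia.
- by have /= := edge_range h2; lia.
- have -> : adeg (true, (s, t, (t, t.+1))) = 0%N by rewrite /adeg /wd /=; lia.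
  have -> : adeg (false, (s, t, (w, s))) = 1%N by rewrite /adeg /wd /=; lia.
  rewrite wd_leE0 // wd_leE1 // /tgt /= => ra rb.
  apply: (ML w _ h1 h2 h3 _ (or_introl erefl)) => //.
    by apply/orP; left; rewrite /is_side xpair_eqE /=; lia.
  move: (NC _ _ Est) (NC _ _ h2) (NC _ _ h3) ra rb h1 s'1 s't' k2.
  by rewrite /crossing /reach /=; clear; case: k => [|[|[|k]]] /=; lia.
- have -> : adeg (true, (s, t, (1%N, n))) = 1%N by rewrite /adeg /wd /=; lia.
  have -> : adeg (false, (s, t, (w, s))) = 1%N by rewrite /adeg /wd /=; lia.
  rewrite !wd_leE1 // /tgt /= => ra rb.
  apply: (ML w _ h1 h2 h3 _ (or_introl erefl)) => //.
    apply/orP; left; apply/negP; rewrite /is_side xpair_eqE /= => tw.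
    by apply: (incident_nocross k3 h2); lia.
  move: (NC _ _ Est) (NC _ _ h2) (NC _ _ h3) ra rb h1 s'1 s't' k2 k1.
  by rewrite /crossing /reach /=; clear; case: k => [|[|[|k]]] /=; lia.
- by have /= := edge_range h2; lia.
Qed.

Lemma ed_range v w : E (ed v w) -> (1 <= v)%N /\ (v <= n)%N.
Proof. by move/edge_range; rewrite /ed /=; clear; lia. Qed.

Lemma path_wd e f s : E e -> pathb A e f s -> (wd e f <= sdeg s)%N /\ E f.
Proof.
elim: s e => [|a s IH] e Ee /andP[].
  by move=> _ /eqP <-; rewrite wd_refl //=; case/and3P: (edge_range Ee).
case/and3P=> aA /eqP sa sP sE; have /andP[_ Et] := arrow_edges aA.
have [|wf Ef] := IH _ Et; first exact/andP.
split=> //; apply: leq_trans (leq_add (leqnn (adeg a)) wf).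
rewrite /adeg sa; apply: wd_triangle.
- by case/and3P: (edge_range Ee).
- by case/and3P: (edge_range Et).
- by case/and3P: (edge_range Ef).
Qed.

Lemma path_mass e f s : E e -> pathb A e f s ->
  (e.1 + e.2 + (s != [::]) <= f.1 + f.2 + sdeg s * n)%N.
Proof.
case: s => [|a s] Ee; first by case/andP=> _ /eqP <- /=; rewrite addn0.
case/andP=> /and3P[aA /eqP sa sP] sE; have /andP[_ Et] := arrow_edges aA.
have [|wf Ef] := @path_wd (tgt a) f s Et; first exact/andP.
have := wd_mass Et Ef wf; have := arrow_mass aA.
by rewrite sdeg_cons mulnDl sa /=; lia.
Qed.

(** The prefix [x] lets the induction absorb a common first arrow, so that no separate congruence
    for left multiplication is needed. *)
Definition thin (e f : edge) (k : nat) : Prop :=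
  forall s1 s2 e0 x, pathb A e f s1 -> pathb A e f s2 ->
    sdeg s1 = k -> sdeg s2 = k -> last e0 (map tgt x) = e ->
    path_equiv K n sigma (e0, x ++ s1) (e0, x ++ s2).

(** Let [g] be the arrow after [a] in the triangle, and [r] a path from [ed v w] to [f] of the
    remaining degree. The chain is a p ~ a g r ~ b t2 r ~ b q: the outer steps are the induction
    after [a] and after [b], the middle one is the relation of [c]. *)
Lemma merging_equiv e f k a b p q e0 x : E e -> E f ->
  a \in A -> b \in A -> src a = e -> src b = e ->
  (forall c, c \in A -> src c = e -> c = a \/ c = b) ->
  (forall c, c \in A -> src c = e -> (adeg c <= k)%N -> thin (tgt c) f (k - adeg c)) ->
  pathb A (tgt a) f p -> pathb A (tgt b) f q ->
  (adeg a + sdeg p = k)%N -> (adeg b + sdeg q = k)%N ->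
  last e0 (map tgt x) = e ->
  forall v w w', ccw v w w' -> E (ed v w) -> E (ed v w') -> E (ed w w') ->
  ~~ is_side n (ed v w) || ~~ is_side n (ed v w') -> ed v w' = e ->
  pivot_arrow w' v w = a ->
  (wd (ed v w) f + (adeg (pivot_arrow w' v w) + adeg (pivot_arrow w w' v)) <= k)%N ->
  path_equiv K n sigma (e0, x ++ a :: p) (e0, x ++ b :: q).
Proof.
move=> Ee Ef aA bA sa sb two IH pP qP dp dq xe v w w' cw Ew Ew' Eww' ns ee ea le_k.
set c := pivot_arrow v w w'; set g := pivot_arrow w w' v.
have iv : incident sigma v by case/orP: ns; apply: diag_incident.
have [v1 vn] := ed_range Ew.
have ww' : w != w' by move: cw; rewrite /ccw; clear; lia.
have vw : v != w by move: cw; rewrite /ccw; clear; lia.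
have vw' : w' != v by move: cw; rewrite /ccw; clear; lia.
have /andP[cw1 cw2] := ccw_rot cw.
set B := fan v (nbrs n sigma v) ++ [:: ext_arrow n v].
have cB : c \in B by rewrite mem_cat triangle_fan.
have Bc := big_chain v1 vn iv.
have Be : last (ed v (nextv n v)) (map tgt B) = ed v (nextv n v).
  by rewrite /B map_cat last_cat.
have /andP[r2c /eqP r2e] := chain_rot Bc Be cB.
have r2d := sdeg_rot cB; rewrite sdeg_big // in r2d.
set r2 := behead _ in r2c r2e r2d.
have tc : tgt c = e by rewrite /c /pivot_arrow /tgt /= ee.
have sc : src c = ed v w by [].
have r2B : {subset r2 <= B} by move=> y /mem_behead; rewrite mem_rot.
have dE := deriv_pivot cw Ew Ew' Eww' iv; rewrite -/c -/B -/r2 in dE.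
have gA : g \in A by apply: pivot_arrow_in => //; rewrite 1?edC // edC.
have sg : src g = tgt a by rewrite -ea /g /pivot_arrow /src /tgt /= edC.
have tg : tgt g = ed v w by rewrite /g /pivot_arrow /tgt /= edC.
rewrite ea -/g in le_k dE.
have dcag : (adeg c + (adeg a + adeg g) = 1)%N.
  rewrite -ea /g adeg_pivot2 //; move: (adeg_pivot cw) (cw); rewrite -/c /ccw.
  by move: (adeg c); clear; lia.
have [|r rP rk] := @path_exists (ed v w) f (k - (adeg a + adeg g)) Ew Ef.
  by move: le_k; clear; lia.
(* The path [r2] runs inside the big cycle at [v], while [a] turns around [w']; as [e] has only two
   outgoing arrows, [r2] starts with [b]. *)
have [t2 r2E] : exists t2, r2 = b :: t2.
  case r2E: r2 r2c r2e r2B => [|h t2].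
    by move=> _ ts; rewrite (@ed_inj v w' w ts) eqxx in ww'.
  move=> /and3P[hA /eqP sh _] _ sub; exists t2.
  have [ha|-> //] := two h hA (etrans sh tc).
  have := sub h (mem_head _ _); rewrite ha -ea => /(pivot_in_big vw) wv.
  by rewrite wv eqxx in vw'.
have cgen := pivot_gen cw Ew Ew' Eww' ns.
apply: (@path_equiv_trans _ _ _ _ (e0, x ++ a :: g :: r)).
  rewrite -!(cat_rcons a); apply: (IH a) => //.
  - by move: dcag le_k; clear; lia.
  - case/andP: rP => rc re; apply/andP; split; last by rewrite /= tg.
    by rewrite /= gA sg eqxx tg.
  - by move: dp; clear; lia.
  - by rewrite sdeg_cons rk; move: le_k; clear; lia.
  - by rewrite map_rcons last_rcons.
apply: (@path_equiv_trans _ _ _ _ (e0, x ++ r2 ++ r)).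
  apply: (deriv_path_equiv (c := c) (r1 := [:: a; g])) => //.
  - by rewrite xe tc.
rewrite r2E /= -!(cat_rcons b); apply: (IH b) => //.
- by move: dq; clear; lia.
- rewrite r2E in r2c r2e; move: r2c r2e rP => /= /and3P[_ _ t2c] t2e /andP[rc re].
  by rewrite /pathb chain_ok_cat map_cat last_cat t2c t2e sc rc re.
- rewrite r2E sdeg_cons in r2d; rewrite sdeg_cat rk.
  by move: r2d dcag le_k; clear; lia.
- by move: dq; clear; lia.
- by rewrite map_rcons last_rcons.
Qed.

Lemma path_thin e f k : E e -> E f -> thin e f k.
Proof.
move: {2}(f.1 + f.2 + k * n - (e.1 + e.2)).+1%N
  (ltnSn (f.1 + f.2 + k * n - (e.1 + e.2))) => m.
elim: m => // m IH in e k * => lt_m Ee Ef s1 s2 e0 x p1 p2 d1 d2 xe.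
have IHa a : a \in A -> src a = e -> (adeg a <= k)%N ->
    (wd (tgt a) f <= k - adeg a)%N -> thin (tgt a) f (k - adeg a).
  move=> aA sa ak wa; have /andP[_ Et] := arrow_edges aA; apply: IH => //.
  have mass := arrow_mass aA; rewrite sa in mass.
  have mass' := wd_mass Et Ef wa.
  have le_ak : (adeg a * n <= k * n)%N by rewrite leq_mul2r ak orbT.
  by move: lt_m mass mass' le_ak; rewrite mulnBl; clear; lia.
case: s1 s2 p1 p2 d1 d2 => [|a p] [|b q] p1 p2 d1 d2.
- exact: path_equiv_refl.
(* An empty path forces [e = f] and [k = 0], but a nonempty closed path has positive degree. *)
- have := path_mass Ee p2; have := path_mass Ee p1; rewrite d1 d2 /=.
  by case/andP: p1 => _ /eqP <-; move: d1 => <-; rewrite /sdeg /=; clear; lia.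
- have := path_mass Ee p2; have := path_mass Ee p1; rewrite d1 d2 /=.
  by case/andP: p2 => _ /eqP <-; move: d2 => <-; rewrite /sdeg /=; clear; lia.
case/andP: p1 => /and3P[aA /eqP sa pc] pe.
case/andP: p2 => /and3P[bA /eqP sb qc] qe.
have pP : pathb A (tgt a) f p by apply/andP.
have qP : pathb A (tgt b) f q by apply/andP.
have /andP[_ Ea] := arrow_edges aA; have /andP[_ Eb] := arrow_edges bA.
rewrite sdeg_cons in d1; rewrite sdeg_cons in d2.
have [wa _] := path_wd Ea pP; have [wb _] := path_wd Eb qP.
have [ab|nab] := eqVneq a b.
  subst b; rewrite -!(cat_rcons a); apply: (IHa a aA sa) => //.
  - by rewrite -d1 leq_addr.
  - by rewrite -d1 addKn.
  - by rewrite -d1 addKn.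
  - by rewrite -d2 addKn.
  - by rewrite map_rcons last_rcons.
have [c0 a_out] : exists c0, out_spec e.1 e.2 c0 a by apply: out_arrowP; case: (e) sa.
have [d0 b_out] : exists d0, out_spec e.1 e.2 d0 b by apply: out_arrowP; case: (e) sb.
have Ee' : E (e.1, e.2) by case: (e) Ee.
have ncd : c0 <> d0 by move/(out_spec_inj Ee' a_out b_out)/eqP; apply/negP.
have lt3 u z : out_spec e.1 e.2 u z -> (u < 3)%N by case.
have two c : c \in A -> src c = e -> c = a \/ c = b.
  move=> cA sc; have [u c_out] : exists u, out_spec e.1 e.2 u c by apply: out_arrowP; case: (e) sc.
  case: (eqVneq u c0) => [uc|uc]; first by left; apply: out_spec_inj c_out a_out uc.
  case: (eqVneq u d0) => [ud|ud]; first by right; apply: out_spec_inj c_out b_out ud.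
  have T := out_spec_three Ee';
  move: uc ud ncd (lt3 _ _ c_out) (lt3 _ _ a_out) (lt3 _ _ b_out) (a_out) (b_out) (c_out).
  clear a_out b_out c_out.
  by case: c0 => [|[|[|?]]] //; case: d0 => [|[|[|?]]] //; case: u => [|[|[|?]]] // *; exfalso; eauto.
have IHc c : c \in A -> src c = e -> (adeg c <= k)%N -> thin (tgt c) f (k - adeg c).
  by move=> cA sc ck; apply: IHa => //; case: (two c cA sc) => ->;
    rewrite -1?d1 ?addKn // d1 -d2 addKn.
have ra : (wd (tgt a) f + adeg a <= k)%N by rewrite -d1 addnC leq_add2l.
have rb : (wd (tgt b) f + adeg b <= k)%N by rewrite -d2 addnC leq_add2l.
have [v [w [w' [h1 h2 h3 h4 [h5 h6 h7 h8]]]]] : merging e f k a b.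
  have ee : e = (e.1, e.2) by case: (e).
  case: (ltngtP c0 d0) => // lt_cd; rewrite ee.
    exact: out_spec_merging a_out b_out lt_cd ra rb.
  have [v [w [w' [h1 h2 h3 h4 [h5 h6 h7 h8]]]]] := out_spec_merging Ee' Ef b_out a_out lt_cd rb ra.
  by exists v, w, w'; split=> //; split=> //; case: h7; [right|left].
case: h7 => h7.
  exact: (merging_equiv Ee Ef aA bA sa sb two IHc pP qP d1 d2 xe h1 h2 h3 h4 h5 h6 h7 h8).
apply: path_equiv_sym.
apply: (merging_equiv Ee Ef bA aA sb sa _ IHc qP pP d2 d1 xe h1 h2 h3 h4 h5 h6 h7 h8).
by move=> c cA sc; case: (two c cA sc); [right|left].
Qed.

(** * The algebra as a tiled order *)

Local Notation valid := (valid n sigma).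
Local Notation entry := (@mx_entry K n sigma).
Local Notation joins := (joining n sigma).

Lemma valid_pathb p : valid p -> pathb A p.1 (pend p) p.2.
Proof. by case/andP => _ cp; rewrite /pathb cp /pend eqxx. Qed.

Lemma pathb_valid e f s : E e -> pathb A e f s -> valid (e, s) && (pend (e, s) == f).
Proof. by move=> Ee /andP[c l]; rewrite /Defs.valid /pend /= mem_edges Ee c. Qed.

Lemma valid_edges p : valid p -> E p.1 && E (pend p).
Proof.
move=> vp; have /andP[+ _] := vp; rewrite mem_edges => Ep; rewrite Ep.
by have [] := path_wd Ep (valid_pathb vp).
Qed.

Lemma valid_cat e s s' :
  valid (e, s ++ s') = valid (e, s) && valid (pend (e, s), s').
Proof.
rewrite /Defs.valid /pend /= chain_ok_cat; apply/idP/idP => [/and3P[h1 h2 h3]|].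
  rewrite h1 h2 h3 andbT /=.
  have v : valid (e, s) by rewrite /Defs.valid /= h1 h2.
  by have /andP[_ Ep] := valid_edges v; rewrite mem_edges andbT; apply: Ep.
by case/and3P=> /andP[-> ->] _ ->.
Qed.

Lemma entry_out u e f : ~~ (E e && E f) -> entry u e f = 0.
Proof.
move=> nE; rewrite /mx_entry big_pred0 // => t; apply/negP => /and3P[v /eqP e1 /eqP e2].
by have := valid_edges v; rewrite e1 e2 (negPf nE).
Qed.

Lemma entry_wd u e f : exists q, entry u e f = 'X^(wd e f) * q.
Proof.
elim: u => [|t u [q IH]]; first by exists 0; rewrite entry_nil mulr0.
rewrite entry_cons IH; case: (boolP (joins e f t.2)) => [/and3P[v /eqP e1 /eqP e2]|_].
  have Ee : E t.2.1 by case/andP: (valid_edges v).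
  have [le_wd _] := path_wd Ee (valid_pathb v); rewrite e1 e2 in le_wd.
  exists (t.1 *: 'X^(sdeg t.2.2 - wd e f) + q).
  by rewrite scale1r mulrDr -scalerAr -exprD subnKC.
by exists q; rewrite scale0r add0r.
Qed.

Lemma entry_mul u v e g :
  entry (fmul u v) e g = \sum_(f <- edges n sigma) entry u e f * entry v f g.
Proof.
elim: u => [|t u IH].
  by rewrite entry_nil big1 // => f _; rewrite entry_nil mul0r.
rewrite /fmul /= -/(fmul u v) entry_cat IH.
under [RHS]eq_bigr => f _ do rewrite entry_cons mulrDl.
rewrite big_split /=; congr (_ + _); elim: v {IH} => [|t' v IH].
  by rewrite entry_nil big1 // => f _; rewrite entry_nil mulr0.
under [RHS]eq_bigr => f _ do rewrite entry_cons mulrDr.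
rewrite big_split /= -IH {IH}; case: ifP => [/eqP pe|/eqP npe] /=; last first.
  rewrite big1 ?add0r // => f _; rewrite /joining.
  case: eqP; rewrite ?andbF ?scale0r ?mul0r // => _.
  case: eqP; rewrite ?andbF ?scale0r ?mul0r // => pf.
  by case: eqP; rewrite ?andbF ?scale0r ?mulr0 // => pf'; case: npe; rewrite pf pf'.
rewrite entry_cons; congr (_ + _); rewrite /= sdeg_cat exprD.
have -> : joins e g (t.2.1, t.2.2 ++ t'.2.2) = joins e (pend t.2) t.2 && joins (pend t.2) g t'.2.
  have -> : pend t.2 = t'.2.1 by [].
  have pE : pend (t.2.1, t.2.2 ++ t'.2.2) = pend t'.2.
    by rewrite /pend /= map_cat last_cat -/(pend t.2) pe.
  have vE : valid (t.2.1, t.2.2 ++ t'.2.2) = valid t.2 && valid t'.2.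
    by rewrite valid_cat -surjective_pairing pe -surjective_pairing.
  rewrite /joining pE vE pe !eqxx andbT /=.
  by case: valid; case: valid; rewrite ?andbF.
case: (boolP (joins e (pend t.2) t.2)) => [j|nj] /=; last first.
  rewrite scale0r big1 // => f _; case: (boolP (joins e f t.2)); rewrite ?scale0r ?mul0r //.
  by case/and3P=> vt h /eqP pf; rewrite /joining vt h eqxx in nj.
have Ep : pend t.2 \in edges n sigma.
  by rewrite mem_edges; case/and3P: j => /valid_edges/andP[].
rewrite (bigD1_seq _ Ep edges_uniq) /= big1 => [|f nf]; last first.
  case: (boolP (joins e f t.2)); rewrite ?scale0r ?mul0r //.
  by case/and3P=> _ _ /eqP pf; rewrite pf eqxx in nf.
rewrite addr0 j scale1r -!scalerAr -!scalerAl !scalerA.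
by congr (_ *: _); rewrite mulrAC mulrA.
Qed.

(** The two terms are parallel paths of degree [1 - adeg c] with opposite signs. *)
Lemma entry_deriv c e f : c \in gen_arrows n sigma ->
  entry (Defs.deriv c (potential K n sigma)) e f = 0.
Proof.
move=> cg; have [v [w [w' [cw Ew Ew' Eww' [iv cE]]]]] := gen_arrow_pivot cg.
subst c; rewrite deriv_pivot //; set c := pivot_arrow v w w'; set B := _ ++ _.
have [v1 vn] := ed_range Ew.
have Bc := big_chain v1 vn iv; rewrite -/B in Bc.
have Be : last (ed v (nextv n v)) (map tgt B) = ed v (nextv n v).
  by rewrite /B map_cat last_cat.
have cB : c \in B by rewrite mem_cat triangle_fan.
have r2P := chain_rot Bc Be cB.
have r2d := sdeg_rot cB; rewrite sdeg_big // in r2d.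
have Et : E (tgt c) by [].
have /andP[v2 /eqP e2] := pathb_valid Et r2P.
have /andP[cw1 cw2] := ccw_rot cw.
have r1P : pathb A (tgt c) (src c) [:: pivot_arrow w' v w; pivot_arrow w w' v].
  have g1 : pivot_arrow w' v w \in A by apply: pivot_arrow_in => //; rewrite edC.
  have g2 : pivot_arrow w w' v \in A by apply: pivot_arrow_in => //; rewrite edC.
  rewrite /pathb /= g1 g2 /src /tgt /=.
  by rewrite (edC w' v) (edC w' w) (edC w v) !eqxx.
have /andP[v1' /eqP e1] := pathb_valid Et r1P.
rewrite !entry_cons entry_nil /joining /= v1' v2 e1 e2 addr0.
have -> : sdeg [:: pivot_arrow w' v w; pivot_arrow w w' v] = sdeg (behead (rot (index c B) B)).
  rewrite !sdeg_cons [sdeg [::]]/= addn0 adeg_pivot2 //.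
  move: r2d (adeg_pivot cw) (cw); rewrite -/c /ccw; move: (sdeg _) (adeg c); clear; lia.
by rewrite scale1r scaleN1r scalerN addrN.
Qed.

Lemma entry_inJ (u : fsum K) e f : inJ n sigma u -> entry u e f = 0.
Proof.
case=> l [/allP lg lu]; rewrite (entry_eqKQ _ _ lu) entry_flatten big_seq big1 // => x xl.
rewrite entry_scale entry_mul big1 ?scaler0 // => g _.
rewrite entry_mul big1 ?mul0r // => h _.
by rewrite entry_deriv ?mulr0 //; apply: lg.
Qed.

(** The choice depends only on the endpoints and the degree of [p], so parallel paths of equal
    degree get literally the same representative. *)
Definition canonical_path (p : qpath) : qpath :=
  (p.1, epsilon (inhabits [::])
          (fun s => pathb A p.1 (pend p) s /\ sdeg s = sdeg p.2)).

Lemma canonical_pathP p : valid p ->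
  pathb A p.1 (pend p) (canonical_path p).2 /\ sdeg (canonical_path p).2 = sdeg p.2.
Proof.
move=> vp; apply: (epsilon_spec _ (fun s => pathb A p.1 (pend p) s /\ sdeg s = sdeg p.2)).
by exists p.2; rewrite valid_pathb.
Qed.

Lemma canonical_equiv (u : fsum K) :
  Gequiv n sigma u [seq (t.1, canonical_path t.2) | t <- u & valid t.2].
Proof.
elim: u => [|[k p] u IH] /=; first exact: inJ_nil.
case: ifP => vp; last first.
  apply: inJ_eqKQ IH => q; rewrite /fsub !coef_cat !coef_cons vp andbF mulr0 add0r.
  by [].
have [cP cd] := canonical_pathP vp; have /andP[Ep Eq] := valid_edges vp.
have := @path_thin p.1 (pend p) (sdeg p.2) Ep Eq _ _ p.1 [::] (valid_pathb vp) cP erefl cd erefl.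
move/(inJ_scale k) => /= H; apply: inJ_eqKQ (inJ_cat H IH) => q.
rewrite /fsub !coef_cat !coef_scale !coef_cons !coef_nil /=.
by rewrite /=; ring.
Qed.

(** Once all paths are replaced by representatives, the coefficient of a representative is a
    coefficient of the polynomial [entry u e f], and so vanishes. *)
Lemma entry0_inJ (u : fsum K) : (forall e f, entry u e f = 0) -> inJ n sigma u.
Proof.
move=> u0; apply: inJ_eqKQ (canonical_equiv u) => p.
rewrite /fsub coef_cat coef_scale; set cu := [seq _ | t <- u & _].
suff -> : coef n sigma cu p = 0 by rewrite mulr0 addr0.
case: (boolP (valid p)) => vp; last first.
  by rewrite /coef big_pred0 // => t; case: eqP => [->|]; rewrite ?(negPf vp) ?andbF.
rewrite coef_map_valid //.
case: (boolP (has (fun t => valid t.2 && (canonical_path t.2 == p)) u)) => [/hasP|no]; last first.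
  by rewrite big_hasC.
move=> [t0 _ /andP[v0 /eqP c0]].
have := u0 t0.2.1 (pend t0.2) => /(congr1 (fun P : {poly K} => P`_(sdeg t0.2.2))).
rewrite coef_entry coef0 => H; rewrite -[RHS]H; apply: eq_bigl => t; rewrite /joining -c0.
apply/andP/andP => [[vt /eqP ct]|[/and3P[vt /eqP h1 /eqP h2] /eqP h3]]; last first.
  by rewrite /canonical_path h1 h2 h3.
have [ctP ctd] := canonical_pathP vt; have [c0P c0d] := canonical_pathP v0.
have e1 : t.2.1 = t0.2.1 by move/(congr1 fst): ct.
rewrite e1 ct in ctP; rewrite vt -ctd ct c0d e1 !eqxx; split=> //.
by case/andP: ctP => _ /eqP <-; case/andP: c0P => _ /eqP <-; rewrite eqxx.
Qed.

Lemma Gequiv_entry (u v : fsum K) :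
  Gequiv n sigma u v <-> forall e f, entry u e f = entry v e f.
Proof.
split=> [uv e f|uv].
  by apply/eqP; rewrite -subr_eq0 -entry_fsub; apply/eqP/entry_inJ.
by apply: entry0_inJ => e f; rewrite entry_fsub uv subrr.
Qed.

Lemma realize_entry e f q : E e -> E f -> exists u, forall e' f',
  entry u e' f' = if (e' == e) && (f' == f) then 'X^(wd e f) * q else 0.
Proof.
move=> Ee Ef; rewrite -[q]coefK poly_def; move: (size q) => m.
elim: m => [|m [u IH]].
  by exists [::] => e' f'; rewrite entry_nil big_ord0 mulr0 if_same.
have [|s sP sd] := @path_exists e f (wd e f + m) Ee Ef; first exact: leq_addr.
have /andP[vs /eqP es] := pathb_valid Ee sP.
exists ((q`_m, (e, s)) :: u) => e' f'.
rewrite entry_cons IH /joining vs es /= sd big_ord_recr /= mulrDr.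
rewrite ![_ == e']eq_sym ![_ == f']eq_sym.
by case: ifP => _; rewrite ?scale0r ?addr0 // scale1r addrC -scalerAr exprD.
Qed.

Lemma realize (P : edge -> edge -> {poly K}) :
  (forall e f, E e -> E f -> exists q, P e f = 'X^(wd e f) * q) ->
  exists u, forall e f, E e -> E f -> entry u e f = P e f.
Proof.
move=> PX; suff H (S : seq (edge * edge)) : uniq S -> {subset S <= [pred x | E x.1 && E x.2]} ->
    exists u, forall e f, entry u e f = if (e, f) \in S then P e f else 0.
  have [||u uP] := H [seq (e, f) | e <- edges n sigma, f <- edges n sigma].
  - apply: allpairs_uniq; rewrite ?edges_uniq //.
    by move=> [? ?] [? ?] _ _ [-> ->].
  - by move=> x /allpairsP[y [+ + ->]]; rewrite !mem_edges inE => -> ->.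
  by exists u => e f Ee Ef; rewrite uP allpairs_f // mem_edges.
elim: S => [|[e f] S IH] /=; first by exists [::] => e f; rewrite entry_nil.
case/andP=> nS uS sub; have [|u uP] := IH uS.
  by move=> x xS; apply: sub; rewrite inE xS orbT.
have /andP[/= Ee Ef] := sub _ (mem_head _ _).
have [q qP] := PX e f Ee Ef; have [v vP] := realize_entry q Ee Ef.
exists (v ++ u) => e' f'; rewrite entry_cat vP uP inE xpair_eqE.
case: ifP => [/andP[/eqP-> /eqP->]|_] /=; last by rewrite add0r.
by rewrite (negPf nS) addr0 qP.
Qed.

Lemma edge_side i : E (@side_of n i).
Proof. by rewrite /is_edge is_side_side_of. Qed.

Lemma sum_sides (M : nmodType) (F : edge -> M) :
  (forall e, ~~ is_side n e -> F e = 0) ->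
  \sum_(e <- edges n sigma) F e = \sum_(i < n) F (side_of i).
Proof.
move=> F0; rewrite (bigID (is_side n)) /= [X in _ + X]big1 // addr0 -big_filter.
have inj := side_of_inj n_ge3.
rewrite (perm_big [seq side_of i | i <- enum 'I_n]) ?big_map ?big_enum //.
apply: uniq_perm => [||e].
- by apply: filter_uniq; apply: edges_uniq.
- by rewrite map_inj_uniq ?enum_uniq.
rewrite mem_filter mem_edges /is_edge.
apply/idP/mapP => [/andP[/(side_ofP n_ge3)[i ->] _]|[i _ ->]].
  by exists i; rewrite ?mem_enum.
by rewrite is_side_side_of.
Qed.

Lemma wd_side i f : E f -> (wd (@side_of n i) f)%:Z = stexp f.1 f.2 i - shift i.
Proof. by case/edge_range/and3P=> f1 f12 f2; apply: wd_side_of; rewrite ?f1. Qed.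

Lemma wd_sides i j : (wd (@side_of n i) (side_of j))%:Z = cexp i j + shift j - shift i.
Proof. by rewrite wd_side ?edge_side // cexp_side_of // subrK. Qed.

Lemma wd_side_attained e f : E e -> E f ->
  exists c : 'I_n, wd (side_of c) f = (wd (side_of c) e + wd e f)%N.
Proof.
move=> /edge_range/and3P[e1 e12 e2] /edge_range/and3P[f1 f12 f2].
by apply: wd_attained; rewrite ?e1 ?f1.
Qed.

(** Guarantees that [tri_of] never returns its default, so that [cyc_at] is a genuine cycle. *)
Lemma edge_in_triangle e : E e ->
  exists2 t, t \in triangles n sigma & has (fun a => src a == e) (tri_arrows t).
Proof.
case: e => s t Est; have /and3P[/= s1 st tn] := edge_range Est.
have [st1|st1] := eqVneq (s, t) (1, n)%N.
  have [|w [sw wt Esw Ewt]] := inner_triangle Est; first by case: st1; lia.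
  by exists (s, w, t); rewrite ?mem_triangles ?sw ?wt ?Esw ?Ewt //= /src /= eqxx ?orbT.
case: (outer_triangle Est st1) => -[w [h1 h2 h3]].
  by exists (s, t, w); rewrite ?mem_triangles ?h1 ?st ?Est ?h2 ?h3 //= /src /= eqxx.
by exists (w, s, t); rewrite ?mem_triangles ?h1 ?st ?Est ?h2 ?h3 //= /src /= eqxx ?orbT.
Qed.

Lemma triangle_cycle i j k : (i, j, k) \in triangles n sigma ->
  [/\ chain_ok A (i, j) (tri_arrows (i, j, k)),
      last (i, j) (map tgt (tri_arrows (i, j, k))) = (i, j) &
      sdeg (tri_arrows (i, j, k)) = 1%N].
Proof.
rewrite mem_triangles => /and5P[ij jk Eij Ejk Eik]; split=> //.
  by have [h1 h2 h3] := triangle_arrows ij jk Eij Ejk Eik; rewrite /= h1 h2 h3 /src /tgt !eqxx.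
by move: ij jk; rewrite /sdeg /adeg /wd /=; clear; lia.
Qed.

Lemma cyc_at_path e : E e ->
  pathb A e e (cyc_at n sigma e).2 /\ sdeg (cyc_at n sigma e).2 = 1%N.
Proof.
move=> Ee; rewrite /cyc_at /=; set p := fun a => src a == e.
have : tri_of n sigma e \in [seq t <- triangles n sigma | has p (tri_arrows t)].
  apply: mem_nth; rewrite size_filter -has_count.
  by have [t tT ht] := edge_in_triangle Ee; apply/hasP; exists t.
rewrite mem_filter; case: (tri_of n sigma e) => [[i j] k] /andP[hT tT].
have [Tc Te Td] := triangle_cycle tT.
move: (tT); rewrite mem_triangles => /and5P[ij jk _ _ _].
have := tri_uniq ij jk; move: hT Tc Te Td; move: (tri_arrows _) => T hT Tc Te Td uT.
have hi : (find p T < size T)%N by rewrite -has_find.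
set d : arrow := (false, ((0, 0), (0, 0)))%N.
set a := nth d T (find p T); have aT : a \in T by apply: mem_nth.
have ia : find p T = index a T by rewrite index_uniq.
have /eqP sa : p a by apply: nth_find.
have aA : a \in A.
  have [s1 [s2 [TE _]]] := rot_split aT.
  by move: Tc; rewrite TE chain_ok_cat /= => /and4P[].
have rE : rot (find p T) T = a :: behead (rot (index a T) T).
  by rewrite ia rot_index.
have /andP[rc /eqP re] := chain_rot Tc Te aT.
rewrite rE sdeg_cons sdeg_rot // Td; split=> //.
by rewrite /pathb /= aA sa eqxx rc /= re sa eqxx.
Qed.

Lemma entry_Celt_mul v e f : E e -> entry (fmul (Celt K n sigma) v) e f = 'X * entry v e f.
Proof.
move=> Ee; rewrite entry_mul; have eS : e \in edges n sigma by rewrite mem_edges.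
have CE g : entry (Celt K n sigma) e g = if g == e then 'X else 0.
  rewrite /mx_entry big_map big_mkcond (bigD1_seq e) ?edges_uniq //= big1 => [|h nh].
    have [cP cd] := cyc_at_path Ee; have /andP[vc /eqP pc] := pathb_valid Ee cP.
    have -> : joins e g (cyc_at n sigma e) = (g == e).
      by rewrite /joining [cyc_at _ _ _]surjective_pairing vc pc eqxx eq_sym.
    by rewrite addr0 cd; case: eqP => // _; rewrite scale1r.
  by rewrite /joining /= (negPf nh) andbF.
rewrite (bigD1_seq e) ?edges_uniq //= CE eqxx big1 ?addr0 // => g ne.
by rewrite CE (negPf ne) mul0r.
Qed.

Lemma entry_unitF e f : E e -> is_side n e ->
  entry (unitF K n sigma) e f = (e == f)%:R.
Proof.
move=> Ee se; have eS : e \in edges n sigma by rewrite mem_edges.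
rewrite /mx_entry big_map big_filter_cond big_mkcond (bigD1_seq e) ?edges_uniq //= big1 => [|h nh].
  rewrite /joining /Defs.valid /= eS se eqxx /pend /= addr0.
  by case: eqP => // _; rewrite scale1r expr0.
by rewrite /joining /= (negPf nh) andbF andbF.
Qed.

Lemma entry_inFGF u e f : inFGF n sigma u -> ~~ (is_side n e && is_side n f) ->
  entry u e f = 0.
Proof.
move=> /allP uF nef; rewrite /mx_entry big_seq_cond big_pred0 // => t.
apply/negP=> /andP[/uF + /and3P[vt /eqP te /eqP tf]].
by rewrite vt te tf (negPf nef).
Qed.

Lemma entry_inT u e f : inT n sigma u -> ~~ is_side n e -> entry u e f = 0.
Proof.
move=> /allP uF nef; rewrite /mx_entry big_seq_cond big_pred0 // => t.
apply/negP=> /andP[/uF + /and3P[vt /eqP te _]].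
by rewrite vt te (negPf nef).
Qed.

Lemma inFGF_filter (u : fsum K) :
  inFGF n sigma [seq t <- u | is_side n t.2.1 && is_side n (pend t.2)].
Proof. by apply/allP => t; rewrite mem_filter => /andP[-> _]; rewrite implybT. Qed.

Lemma inT_filter (u : fsum K) :
  inT n sigma [seq t <- u | is_side n t.2.1 && predT (pend t.2)].
Proof. by apply/allP => t; rewrite mem_filter andbT => /andP[-> _]; rewrite implybT. Qed.

Lemma inFGF_inT (u : fsum K) : inFGF n sigma u -> inT n sigma u.
Proof. by apply: sub_all => t /implyP h; apply/implyP => /h/andP[]. Qed.

Lemma inT_cat (u v : fsum K) : inT n sigma (u ++ v) = inT n sigma u && inT n sigma v.
Proof. exact: all_cat. Qed.

Lemma fmul_valid (u v : fsum K) t : t \in fmul u v -> valid t.2 ->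
  exists t1 t2, [/\ t1 \in u, t2 \in v, valid t1.2 & valid t2.2] /\
    [/\ t.2.1 = t1.2.1, pend t1.2 = t2.2.1 & pend t.2 = pend t2.2].
Proof.
case/flattenP=> _ /mapP[t1 t1u ->] /mapP[t2]; rewrite mem_filter => /andP[/eqP pe t2v ->] /=.
rewrite valid_cat -surjective_pairing pe -surjective_pairing => /andP[v1 v2].
exists t1, t2; split=> //; split=> //.
by rewrite /pend /= map_cat last_cat -/(pend t1.2) pe.
Qed.

Lemma inT_fmul (u v : fsum K) : inT n sigma u -> inT n sigma (fmul u v).
Proof.
move=> /allP uT; apply/allP => t tuv; apply/implyP => vt.
have [t1 [t2 [[/uT + _ v1 _] [-> _ _]]]] := fmul_valid tuv vt.
by rewrite v1.
Qed.

Lemma Gequiv_inT (u v : fsum K) : inT n sigma u -> inT n sigma v ->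
  (forall i f, E f -> entry u (@side_of n i) f = entry v (side_of i) f) ->
  Gequiv n sigma u v.
Proof.
move=> uT vT H; apply/Gequiv_entry => e f.
case: (boolP (is_side n e)) => [/(side_ofP n_ge3)[i ->]|se]; last first.
  by rewrite !entry_inT.
by case: (boolP (E f)) => [/H|nf] //; rewrite !entry_out // (negPf nf) andbF.
Qed.

Lemma Gequiv_inFGF (u v : fsum K) : inFGF n sigma u -> inFGF n sigma v ->
  (forall i j, entry u (@side_of n i) (@side_of n j) = entry v (side_of i) (side_of j)) ->
  Gequiv n sigma u v.
Proof.
move=> uF vF H; apply: Gequiv_inT; try exact: inFGF_inT.
move=> i f _; case: (boolP (is_side n f)) => [/(side_ofP n_ge3)[j ->] //|sf].
by rewrite !entry_inFGF // (negPf sf) andbF.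
Qed.

(** * The isomorphisms with the order and with the direct sum *)

Local Notation xF := (tof 'X : {fraction {poly K}}).
Local Notation side_of := (@side_of n).
Local Notation es := (edges n sigma).

Lemma n_gt0 : (0 < n)%N.
Proof. exact: leq_trans n_ge3. Qed.

Definition side_index (e : edge) : 'I_n :=
  odflt (Ordinal n_gt0) [pick i | side_of i == e].

Lemma side_ofK i : side_index (side_of i) = i.
Proof.
rewrite /side_index; case: pickP => [j /eqP /(side_of_inj n_ge3) //|/(_ i)].
by rewrite eqxx.
Qed.

Lemma realize_inT (p : 'I_n -> edge -> {poly K}) :
  exists2 u, inT n sigma u &
    forall i f, E f -> entry u (side_of i) f = 'X^(wd (side_of i) f) * p i f.
Proof.
have [|u uP] := @realize (fun e f => 'X^(wd e f) * p (side_index e) f).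
  by move=> e f _ _; exists (p (side_index e) f).
(* Dropping the paths that do not start at a side leaves the rows of the sides unchanged. *)
exists [seq t <- u | is_side n t.2.1 && predT (pend t.2)]; first exact: inT_filter.
by move=> i f Ef; rewrite entry_filter is_side_side_of //= uP ?edge_side // side_ofK.
Qed.

Lemma realize_inFGF (p : 'I_n -> 'I_n -> {poly K}) :
  exists2 u, inFGF n sigma u &
    forall i j, entry u (side_of i) (side_of j) = 'X^(wd (side_of i) (side_of j)) * p i j.
Proof.
have [|u uP] := @realize (fun e f => 'X^(wd e f) * p (side_index e) (side_index f)).
  by move=> e f _ _; exists (p (side_index e) (side_index f)).
exists [seq t <- u | is_side n t.2.1 && is_side n (pend t.2)]; first exact: inFGF_filter.
by move=> i j; rewrite entry_filter !is_side_side_of //= uP ?edge_side // !side_ofK.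
Qed.

(** Conjugation by the diagonal matrix of the [x^(shift i)] turns the exponents [cexp] into the
    degrees between sides. *)
Definition represents (M : 'M[{fraction {poly K}}]_n) (u : fsum K) : Prop :=
  inFGF n sigma u /\ forall i j,
    tof (entry u (side_of i) (side_of j)) = xF ^ (shift j - shift i) * M i j.

Definition order_map (M : 'M[{fraction {poly K}}]_n) : fsum K :=
  epsilon (inhabits [::]) (represents M).

Lemma order_mapP M : inLam M -> represents M (order_map M).
Proof.
move=> ML; apply: (epsilon_spec _ (represents M)).
have [p pP] : exists p : 'I_n * 'I_n -> {poly K},
    forall x, M x.1 x.2 = xF ^ cexp x.1 x.2 * tof (p x).
  exact: (fin_all_exists (P := fun x p => M x.1 x.2 = xF ^ cexp x.1 x.2 * tof p)
    (fun x => ML x.1 x.2)).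
have [u uF uP] := realize_inFGF (fun i j => p (i, j)).
exists u; split=> // i j; rewrite uP (pP (i, j)) mulrA -xFD.
by apply/esym/xF_tof; rewrite wd_sides /=; ring.
Qed.

Lemma order_map_unique M u : inLam M -> represents M u -> Gequiv n sigma u (order_map M).
Proof.
move=> ML [uF uP]; have [vF vP] := order_mapP ML.
by apply: Gequiv_inFGF => // i j; apply: tof_inj; rewrite uP vP.
Qed.

(** The shifts cancel in the triangle inequality for degrees between sides. This closes Lambda under
    products. *)
Lemma cexp_triangle i j k : (@cexp n i k <= cexp i j + cexp j k)%R.
Proof.
have rs l : [&& 1 <= (side_of l).1, (side_of l).1 < (side_of l).2 & (side_of l).2 <= n]%N.
  exact: edge_range (edge_side l).
have := @wd_triangle (side_of i) (side_of j) (side_of k).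
have := wd_sides i j; have := wd_sides j k; have := wd_sides i k.
by move: (rs i) (rs j) (rs k); clear; lia.
Qed.

Lemma inLamD (M N : 'M[{fraction {poly K}}]_n) : inLam M -> inLam N -> inLam (M + N).
Proof. by move=> ML NL i j; rewrite mxE; apply: latD. Qed.

Lemma inLamM (M N : 'M[{fraction {poly K}}]_n) : inLam M -> inLam N -> inLam (M *m N).
Proof.
move=> ML NL i j; rewrite mxE; apply: lat_sum => k _.
exact: latS (cexp_triangle i k j) (latM (ML i k) (NL k j)).
Qed.

Lemma inLamZ (p : {poly K}) (M : 'M[{fraction {poly K}}]_n) : inLam M -> inLam (tof p *: M).
Proof. by move=> ML i j; rewrite mxE; apply: lat_tofM. Qed.

Lemma inLam1 : inLam (1%:M : 'M[{fraction {poly K}}]_n).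
Proof.
move=> i j; rewrite mxE; case: eqP => [->|_]; last exact: lat0.
by exists 1; rewrite tof1 mulr1 /cexp leqnn; case: ifP => //; have := ltn_ord j; lia.
Qed.

Lemma entry_FGF_mul u v i f : inFGF n sigma u ->
  entry (fmul u v) (side_of i) f =
  \sum_(j < n) entry u (side_of i) (side_of j) * entry v (side_of j) f.
Proof.
move=> uF; rewrite entry_mul sum_sides // => e se.
by rewrite (entry_inFGF uF) ?mul0r // (negPf se) andbF.
Qed.

Lemma inFGF_cat (u v : fsum K) : inFGF n sigma (u ++ v) = inFGF n sigma u && inFGF n sigma v.
Proof. exact: all_cat. Qed.

Lemma inFGF_fmul (u v : fsum K) : inFGF n sigma u -> inFGF n sigma v -> inFGF n sigma (fmul u v).
Proof.
move=> /allP uF /allP vF; apply/allP => t tuv; apply/implyP => vt.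
have [t1 [t2 [[/uF + /vF + v1 v2] [-> _ ->]]]] := fmul_valid tuv vt.
by rewrite v1 v2 /= => /andP[-> _] /andP[_ ->].
Qed.

Lemma inFGF_scale k (u : fsum K) : inFGF n sigma (scale k u) = inFGF n sigma u.
Proof. by rewrite /inFGF all_map. Qed.

Lemma order_map_inFGF M : inLam M -> inFGF n sigma (order_map M).
Proof. by case/order_mapP. Qed.

Lemma entry_order_map M i j : inLam M ->
  tof (entry (order_map M) (side_of i) (side_of j)) = xF ^ (shift j - shift i) * M i j.
Proof. by case/order_mapP. Qed.

Lemma order_map_iso : is_Ralg_iso n sigma order_map.
Proof.
split; first exact: order_map_inFGF.
split.
  move=> M N ML NL; have MNL := inLamD ML NL; apply: Gequiv_inFGF.
  - exact: order_map_inFGF.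
  - by rewrite inFGF_cat !order_map_inFGF.
  move=> i j; apply: tof_inj.
  by rewrite entry_cat tofD !entry_order_map // mxE mulrDr.
split.
  move=> M N ML NL; have MNL := inLamM ML NL; apply: Gequiv_inFGF.
  - exact: order_map_inFGF.
  - by rewrite inFGF_fmul ?order_map_inFGF.
  move=> i j; apply: tof_inj.
  rewrite entry_order_map // entry_FGF_mul ?order_map_inFGF // tof_sum mxE mulr_sumr.
  apply: eq_bigr => k _; rewrite tofM !entry_order_map // mulrACA -xFD.
  by congr (_ ^ _ * _); ring.
split.
  apply: Gequiv_inFGF.
  - exact/order_map_inFGF/inLam1.
  - apply/allP => t /mapP[e]; rewrite mem_filter => /andP[se _] ->.
    by rewrite /pend /= se implybT.
  move=> i j; apply: tof_inj; rewrite entry_order_map; last exact: inLam1.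
  rewrite entry_unitF ?edge_side ?is_side_side_of // mxE (inj_eq (side_of_inj n_ge3)).
  by case: eqP => [->|_]; rewrite ?subrr ?mulr1 ?tof1 // ?mulr0 ?tof0.
split.
  move=> k M ML; have kML := inLamZ k%:P ML; apply: Gequiv_inFGF.
  - exact: order_map_inFGF.
  - by rewrite inFGF_scale order_map_inFGF.
  move=> i j; apply: tof_inj; rewrite entry_scale -mul_polyC tofM !entry_order_map //.
  by rewrite mxE mulrCA.
split.
  move=> M ML; have xML := inLamZ 'X ML; apply: Gequiv_inFGF.
  - exact: order_map_inFGF.
  - apply/allP => t tC; apply/implyP => vt.
    have [t1 [t2 [[/mapP[e + ->] t2M v1 v2] [-> pe ->]]]] := fmul_valid tC vt.
    rewrite mem_edges => Ee; have [/andP[_ /eqP cP] _] := cyc_at_path Ee.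
    have /allP/(_ _ t2M) := order_map_inFGF ML; rewrite v2 -pe /= => /andP[+ ->].
    by rewrite /pend cP andbT.
  move=> i j; apply: tof_inj.
  by rewrite entry_Celt_mul ?edge_side // tofM !entry_order_map // mxE mulrCA.
split.
  move=> M N ML NL /Gequiv_entry MN; apply/matrixP => i j.
  apply: (mulfI (expfz_neq0 (shift j - shift i) (xF_neq0 K))).
  by rewrite -!entry_order_map // MN.
move=> u uF; pose M := \matrix_(i, j) (xF ^ (shift i - shift j) * tof (entry u (side_of i) (side_of j))).
have ML : inLam M.
  move=> i j; rewrite mxE; have [q ->] := entry_wd u (side_of i) (side_of j).
  exists q; rewrite -(xF_tof (c := (wd (side_of i) (side_of j))%:Z)) // mulrA -xFD wd_sides.
  by congr (_ ^ _ * _); ring.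
exists M => //; apply: order_map_unique => //; split=> // i j.
by rewrite mxE mulrA -xFD addrC subrKA subrr mul1r.
Qed.

(** * Endomorphisms *)

(** The factor turns the degree from the i-th side into the i-th exponent of the lattice, and it
    absorbs the conjugation in [represents], which gives Lambda-linearity. *)
Definition module_map (u : fsum K) : 'M[{fraction {poly K}}]_(n, size es) :=
  \matrix_(i, k) (xF ^ shift i * tof (entry u (side_of i) (nth (0, 0)%N es k))).

Lemma nth_edge (k : 'I_(size es)) : E (nth (0, 0)%N es k).
Proof. by rewrite -mem_edges mem_nth. Qed.

Lemma module_map_iso : is_mod_iso n sigma order_map module_map.
Proof.
split.
  move=> u v _ _ /Gequiv_entry uv; apply/matrixP => i k.
  by rewrite !mxE uv.
split.
  move=> u uT i k; rewrite /= mxE; set e := nth _ _ _.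
  have Ee : E e := nth_edge k; have [q ->] := entry_wd u (side_of i) e.
  exists q; rewrite -(xF_tof (c := (wd (side_of i) e)%:Z)) // mulrA -xFD wd_side //.
  by congr (_ ^ _ * _); rewrite addrC subrK.
split.
  by move=> u v _ _; apply/matrixP => i k; rewrite !mxE entry_cat tofD mulrDr.
split.
  move=> M u ML uT; apply/matrixP => i k; rewrite !mxE.
  rewrite entry_FGF_mul ?order_map_inFGF // tof_sum mulr_sumr.
  apply: eq_bigr => j _; rewrite !mxE tofM entry_order_map // !mulrA -xFD.
  by rewrite addrC subrK [M i j * _]mulrC.
split.
  move=> u v uT vT uv; apply: Gequiv_inT => // i f.
  rewrite -mem_edges => fE; have k_lt : (index f es < size es)%N by rewrite index_mem.
  apply: tof_inj; apply: (mulfI (expfz_neq0 (shift i) (xF_neq0 K))).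
  have /matrixP/(_ i (Ordinal k_lt)) := uv.
  by rewrite !mxE /= nth_index.
move=> M MS.
have [p pP] : exists p : 'I_n * 'I_(size es) -> {poly K}, forall x,
    M x.1 x.2 = xF ^ stexp (nth (0, 0)%N es x.2).1 (nth (0, 0)%N es x.2).2 x.1 * tof (p x).
  exact: (fin_all_exists (P := fun x p => M x.1 x.2 =
    xF ^ stexp (nth (0, 0)%N es x.2).1 (nth (0, 0)%N es x.2).2 x.1 * tof p)
    (fun x => MS x.1 x.2)).
(* Columns are numbered by position, entries by edge; as the edges are distinct, the sum picks the
   one position of [f]. *)
have [u uT uP] := realize_inT (fun i f =>
  \sum_(k < size es | nth (0, 0)%N es k == f) p (i, k)).
exists u => //; apply/matrixP => i k; rewrite mxE uP ?nth_edge //.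
rewrite (big_pred1 k); last first.
  by move=> k'; rewrite nth_uniq ?edges_uniq.
rewrite -(xF_tof (c := (wd (side_of i) (nth (0, 0)%N es k))%:Z)) // mulrA -xFD.
by rewrite wd_side ?nth_edge // (pP (i, k)) /= addrC subrK.
Qed.

Lemma fmulA (u v w : fsum K) : Gequiv n sigma (fmul (fmul u v) w) (fmul u (fmul v w)).
Proof.
apply/Gequiv_entry => e g; rewrite !entry_mul.
under eq_bigr => f _ do rewrite entry_mul mulr_suml.
rewrite exchange_big; apply: eq_bigr => f _.
by rewrite entry_mul mulr_sumr; apply: eq_bigr => h _; rewrite mulrA.
Qed.

(** Supplies the elements of Lambda that carry row [j] to row [i]; the power of X is the least one
    allowed in that place. *)
Lemma matrix_unit i j (p : {poly K}) : exists2 M, inLam M &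
  forall v k f, entry (fmul (order_map M) v) (side_of k) f =
    if k == i then 'X^(wd (side_of i) (side_of j)) * p * entry v (side_of j) f else 0.
Proof.
have [u uF uP] := realize_inFGF (fun i' j' => ((i' == i) && (j' == j))%:R * p).
case: (order_map_iso) => _ [_ [_ [_ [_ [_ [_ /(_ u uF)]]]]]] [M ML /Gequiv_entry uM].
exists M => // v k f; rewrite entry_FGF_mul ?order_map_inFGF // (bigD1 j) //= big1 => [|j' nj].
  rewrite -uM uP eqxx andbT addr0; case: eqP => [->|_]; first by rewrite mul1r.
  by rewrite mul0r mulr0 mul0r.
by rewrite -uM uP (negPf nj) andbF mul0r mulr0 mul0r.
Qed.

Definition is_generator i e u : Prop := inT n sigma u /\
  forall j h, E h -> entry u (side_of j) h =
    if (j == i) && (h == e) then 'X^(wd (side_of i) e) else 0.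

(* The unique minimal path from the [i]-th side to [e]. *)
Definition generator i e : fsum K := epsilon (inhabits [::]) (is_generator i e).

Lemma generatorP i e : is_generator i e (generator i e).
Proof.
apply: (epsilon_spec _ (is_generator i e)).
have [u uT uP] := realize_inT (fun j h => ((j == i) && (h == e))%:R).
exists u; split=> // j h Eh; rewrite uP //.
by case: ifP => [/andP[/eqP-> /eqP->]|_]; rewrite ?mulr1 ?mulr0.
Qed.

Section Endomorphism.
Variable f : fsum K -> fsum K.
Hypothesis f_endo : is_Lam_endo n sigma order_map f.

Let f_inT u : inT n sigma u -> inT n sigma (f u).
Proof. by case: f_endo => H _ _ _; apply: H. Qed.

Let f_equiv u v g h : inT n sigma u -> inT n sigma v -> Gequiv n sigma u v ->
  entry (f u) g h = entry (f v) g h.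
Proof. by case: f_endo => _ H _ _ uT vT uv; move/Gequiv_entry: (H u v uT vT uv). Qed.

Let f_cat u v g h : inT n sigma u -> inT n sigma v ->
  entry (f (u ++ v)) g h = entry (f u) g h + entry (f v) g h.
Proof.
by case: f_endo => _ _ H _ uT vT; move/Gequiv_entry: (H u v uT vT) => ->; rewrite entry_cat.
Qed.

Let f_mul M u g h : inLam M -> inT n sigma u ->
  entry (f (fmul (order_map M) u)) g h = entry (fmul (order_map M) (f u)) g h.
Proof. by case: f_endo => _ _ _ H ML uT; move/Gequiv_entry: (H M u ML uT). Qed.

Lemma inT_order_mul M u : inLam M -> inT n sigma (fmul (order_map M) u).
Proof. by move=> ML; apply/inT_fmul/inFGF_inT/order_map_inFGF. Qed.

(** The generator is fixed by the idempotent of the i-th side, and [f] commutes with that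
    idempotent. *)
Lemma endo_generator_row i e j h : E e -> j != i -> entry (f (generator i e)) (side_of j) h = 0.
Proof.
move=> Ee ji; have [bT bP] := generatorP i e.
have [M ML MP] := matrix_unit i i 1.
rewrite (f_equiv _ _ bT (inT_order_mul (generator i e) ML)); last first.
  apply: Gequiv_inT => //; first exact: inT_order_mul.
  move=> k h' Eh'; rewrite MP wd_refl; last by case/and3P: (edge_range (edge_side i)).
  by rewrite expr0 !mul1r !bP // eqxx; case: eqP.
by rewrite f_mul // MP (negPf ji).
Qed.

(** Suitable multiples of the matrix units (i,j) and (i,i) carry the generators at [j] and at [i] to
    the same element. Applying [f] and cancelling a power of X compares their images. *)
Lemma endo_generator_exchange i j e h : E e -> E h ->
  'X^(wd (side_of i) e) * entry (f (generator j e)) (side_of j) h =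
  'X^(wd (side_of j) e) * entry (f (generator i e)) (side_of i) h.
Proof.
move=> Ee Eh; have [biT biP] := generatorP i e; have [bjT bjP] := generatorP j e.
set a := wd (side_of i) (side_of j).
have [M ML MP] := matrix_unit i j ('X^(wd (side_of i) e)).
have [N NL NP] := matrix_unit i i ('X^(a + wd (side_of j) e)).
have w0 : wd (side_of i) (side_of i) = 0%N.
  by apply: wd_refl; case/and3P: (edge_range (edge_side i)).
have MN : Gequiv n sigma (fmul (order_map M) (generator j e)) (fmul (order_map N) (generator i e)).
  apply: Gequiv_inT; try exact: inT_order_mul.
  move=> k h' Eh'; rewrite MP NP w0 expr0 mul1r; case: eqP => // _.
  rewrite bjP // biP // !eqxx /=; case: eqP => _; last by rewrite !mulr0.
  by rewrite -/a exprD mulrAC.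
have := f_equiv (side_of i) h (inT_order_mul _ ML) (inT_order_mul _ NL) MN.
rewrite !f_mul // MP NP eqxx w0 expr0 mul1r -/a exprD -!mulrA.
by apply: mulfI; rewrite expf_neq0 // polyX_eq0.
Qed.

(** For the side [c] with [wd c h = wd c e + wd e h] the divisibility is automatic; the exchange
    formula transports it, with the same [q], to every other side. *)
Lemma endo_entry e h : E e -> E h -> exists q, forall i,
  entry (f (generator i e)) (side_of i) h = 'X^(wd (side_of i) e) * ('X^(wd e h) * q).
Proof.
move=> Ee Eh; have [c cP] := wd_side_attained Ee Eh.
have [q qP] := entry_wd (f (generator c e)) (side_of c) h.
exists q => i; have := endo_generator_exchange c i Ee Eh.
rewrite qP cP exprD -mulrA [RHS]mulrCA.
by apply: mulfI; rewrite expf_neq0 // polyX_eq0.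
Qed.

(** The quotients from [endo_entry] are the entries of [g]. The two maps agree on the generators,
    hence on their Lambda-span, which is all of e_F Gamma up to J. *)
Lemma endo_right_mult : exists g : fsum K, forall u, inT n sigma u ->
  Gequiv n sigma (f u) (fmul u g).
Proof.
pose is_q e h q := forall i, entry (f (generator i e)) (side_of i) h =
  'X^(wd (side_of i) e) * ('X^(wd e h) * q).
pose q e h : {poly K} := epsilon (inhabits 0) (is_q e h).
have qP e h : E e -> E h -> is_q e h (q e h).
  by move=> Ee Eh; apply: (epsilon_spec _ (is_q e h)); apply: endo_entry.
have [|g gP] := @realize (fun e h => 'X^(wd e h) * q e h).
  by move=> e h _ _; exists (q e h).
exists g; pose good u := inT n sigma u /\
  forall i h, E h -> entry (f u) (side_of i) h = entry (fmul u g) (side_of i) h.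
have good_cat u v : good u -> good v -> good (u ++ v).
  move=> [uT uE] [vT vE]; split=> [|i h Eh]; first by rewrite inT_cat uT.
  rewrite f_cat // uE // vE // !entry_mul -big_split; apply: eq_bigr => e _.
  by rewrite entry_cat mulrDl.
have good_gen i e : E e -> good (generator i e).
  move=> Ee; have [bT bP] := generatorP i e; split=> // j h Eh.
  rewrite entry_mul; have [->|ji] := eqVneq j i; last first.
    rewrite endo_generator_row // big1_seq // => e' /andP[_]; rewrite mem_edges => Ee'.
    by rewrite bP // (negPf ji) mul0r.
  rewrite (bigD1_seq e) ?mem_edges ?edges_uniq //= big1_seq => [|e' /andP[ne]].
    by rewrite addr0 bP // !eqxx gP // qP.
  by rewrite mem_edges => Ee'; rewrite bP // (negPf ne) andbF mul0r.
have good_mul M u : inLam M -> good u -> good (fmul (order_map M) u).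
  move=> ML [uT uE]; split=> [|i h Eh]; first exact: inT_order_mul.
  have /Gequiv_entry-> := fmulA (order_map M) u g.
  rewrite f_mul // !entry_FGF_mul ?order_map_inFGF //.
  by apply: eq_bigr => j _; rewrite uE.
(* A Lambda-combination of generators with the prescribed entries of [u] is built one position (i,e)
   at a time. *)
have good_span u (S : seq ('I_n * edge)) : uniq S -> exists2 v, good v &
    forall i h, E h -> entry v (side_of i) h = if (i, h) \in S then entry u (side_of i) h else 0.
  elim: S => [_|[i e] S IH /= /andP[nS /IH[v vG vP]]].
    exists [::] => [|i h Eh]; last by rewrite entry_nil.
    (* That [f] kills the empty sum follows from additivity on [[::] ++ [::]]. *)
    split=> // i h Eh; have := @f_cat [::] [::] (side_of i) h isT isT.
    by move/eqP; rewrite -subr_eq0 opprD addrA subrr sub0r oppr_eq0 => /eqP ->; rewrite entry_nil.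
  case: (boolP (E e)) => Ee; last first.
    exists v => // k h Eh; rewrite vP // inE xpair_eqE.
    by case: eqP => [ek|]; case: eqP => [eh|] //=; rewrite -eh Eh in Ee.
  have [r rP] := entry_wd u (side_of i) e; have [M ML MP] := matrix_unit i i r.
  have [bT bP] := generatorP i e.
  have w0 : wd (side_of i) (side_of i) = 0%N.
    by apply: wd_refl; case/and3P: (edge_range (edge_side i)).
  exists (fmul (order_map M) (generator i e) ++ v); first by apply/good_cat/vG/good_mul/good_gen.
  move=> k h Eh; rewrite entry_cat MP vP // inE xpair_eqE w0 expr0 mul1r.
  have [->|ki] := eqVneq k i; last by rewrite add0r.
  rewrite bP // eqxx /=; have [->|he] := eqVneq h e; last by rewrite mulr0 add0r.
  by rewrite (negPf nS) addr0 rP mulrC.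
move=> u uT; have [|v [vT vG] vP] := good_span u [seq (i, e) | i <- enum 'I_n, e <- es].
  by apply: allpairs_uniq; rewrite ?enum_uniq ?edges_uniq // => -[? ?] [? ?] _ _ [-> ->].
have uv : Gequiv n sigma u v.
  by apply: Gequiv_inT => // i h Eh; rewrite vP // allpairs_f ?mem_enum // mem_edges.
apply: Gequiv_inT; [exact: f_inT | exact: inT_fmul |] => i h Eh.
rewrite (f_equiv _ _ uT vT uv) vG // !entry_mul; apply: eq_bigr => e _.
by move/Gequiv_entry: uv => ->.
Qed.

End Endomorphism.

Lemma order_map_right_mult : right_mult_iso n sigma order_map.
Proof.
split; last exact: endo_right_mult.
- move=> g; split.
  + by move=> u uT; apply: inT_fmul.
  + move=> u v uT vT /Gequiv_entry uv; apply/Gequiv_entry => e h.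
    by rewrite !entry_mul; apply: eq_bigr => e' _; rewrite uv.
  + move=> u v uT vT; apply/Gequiv_entry => e h.
    rewrite entry_cat !entry_mul -big_split; apply: eq_bigr => e' _.
    by rewrite entry_cat mulrDl.
  + by move=> M u ML uT; apply: fmulA.
move=> g g' gg'; apply/Gequiv_entry => e h.
case: (boolP (E e)) => Ee; last by rewrite !entry_out // (negPf Ee).
case: (boolP (E h)) => Eh; last by rewrite !entry_out // (negPf Eh) andbF.
(* Any side would do: multiplying the generator by [g] puts row [e] of [g], times a power of X, into
   row [i], and that power can be cancelled. *)
pose i := Ordinal n_gt0; have [bT bP] := generatorP i e.
have /Gequiv_entry/(_ (side_of i) h) := gg' _ bT.
have bM w : entry (fmul (generator i e) w) (side_of i) h = 'X^(wd (side_of i) e) * entry w e h.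
  rewrite entry_mul (bigD1_seq e) ?mem_edges ?edges_uniq //= big1_seq => [|e' /andP[ne]].
    by rewrite addr0 bP // !eqxx.
  by rewrite mem_edges => Ee'; rewrite bP // (negPf ne) andbF mul0r.
by rewrite !bM; apply: mulfI; rewrite expf_neq0 // polyX_eq0.
Qed.

End Algebra.

End Triangulation.

Theorem theorem3p9 (K : fieldType) (n : nat) (sigma : seq edge) :
  (3 <= n)%N -> is_triangulation n sigma ->
  exists (phi : 'M[{fraction {poly K}}]_n -> fsum K)
         (psi : fsum K -> 'M[{fraction {poly K}}]_(n, size (edges n sigma))),
    [/\ is_Ralg_iso n sigma phi, is_mod_iso n sigma phi psi
      & right_mult_iso n sigma phi].
Proof.
move=> n_ge3 sigma_tri; exists (@order_map n sigma K), (@module_map n sigma K).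
split; [exact: order_map_iso | exact: module_map_iso | exact: order_map_right_mult].
Qed.
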